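(* Let $\sigma>0$, $\rho>0$, $\alpha>0$, $m=\lceil\alpha\rceil$, $K>0$, $h^*>0$, $b_0,\dots,b_{m-1}\in\mathbb{R}$, and $$ H=\Big\{(t,y)\in\mathbb{R}^2: 0\le t\le h^*,\ \Big|y-e^{-\sigma t^\rho}\sum_{k=0}^{m-1}\frac{b_k}{\Gamma(k+1)}t^{\rho k}\Big|\le K\Big\}. $$ Let $f:H\to\mathbb{R}$ be continuous and bounded, and suppose there is $L>0$ with $|f(t,y)-f(t,\tilde y)|\le L|y-\tilde y|$ for all $(t,y),(t,\tilde y)\in H$. For $c_0,\dots,c_{m-1}\in\mathbb{R}$ let $\psi$ be the solution of $$ {}_\sigma^c D_0^{\alpha,\rho}\psi(t)=f(t,\psi(t))\ (t>0),\qquad {}_\sigma D^{k,\rho}\psi(0)=b_k,\quad k\in\{0,\dots,m-1\}, $$ and let $\phi$ be the solution of $$ {}_\sigma^c D_0^{\alpha,\rho}\phi(t)=f(t,\phi(t))\ (t>0),\qquad {}_\sigma D^{k,\rho}\phi(0)=c_k,\quad k\in\{0,\dots,m-1\}. $$ Let $\epsilon=\max_{k=0,\dots,m-1}|b_k-c_k|$. If $\epsilon$ is sufficiently small, then there is a constant $h>0$ such that $\psi$ and $\phi$ are defined on $[0,h]$ and $$ \sup_{0\le t\le h}|\psi(t)-\phi(t)|=\mathcal{O}(\epsilon). $$ That is, there are constants $\epsilon_0,h,C>0$, not depending on $c_0,\dots,c_{m-1}$, such that whenever $\epsilon\le\epsilon_0$ both solutions are defined on $[0,h]$ and $\sup_{0\le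 t\le h}|\psi(t)-\phi(t)|\le C\epsilon$.
   Context: Differential operator: ${}_\sigma D^{n,\rho}=\big(\frac{t^{1-\rho}}{\rho}\frac{d}{dt}+\sigma\big)^n$ ($n$-fold composition, ${}_\sigma D^{0,\rho}$ the identity); ${}_\sigma D^{k,\rho}\psi(0)$ denotes its value at $0$, understood as the limit as $t\to0^+$. Generalized substantial operators with lower limit $0$: for $\gamma>0$, ${}_\sigma I_0^{\gamma,\rho}\psi(t)=\frac{\rho}{\Gamma(\gamma)}\int_0^t (t^\rho-s^\rho)^{\gamma-1}e^{-\sigma(t^\rho-s^\rho)}s^{\rho-1}\psi(s)\,ds$, ${}_\sigma I_0^{0,\rho}$ is the identity, and for $m-1<\alpha\le m$, ${}_\sigma D_0^{\alpha,\rho}\psi={}_\sigma D^{m,\rho}\,{}_\sigma I_0^{m-\alpha,\rho}\psi$. The generalized Caputo type substantial derivative is $$ {}_\sigma^c D_0^{\alpha,\rho}\psi(t)={}_\sigma D_0^{\alpha,\rho}\Big(\psi(t)-\sum_{k=0}^{m-1}\frac{{}_\sigma D^{k,\rho}\psi(0)}{k!}\,t^{\rho k}e^{-\sigma t^\rho}\Big). $$ A solution of such an initial value problem on $[0,h]$ is a function in $C[0,h]$ with graph contained in $H$, for which the expressions in the problem exist, satisfying the differential equation for $0<t\le h$ and the initial conditions; ''the solution is defined on $[0,h]$'' means that a unique such solution on $[0,h]$ exists. *)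

(* Defs.v *)
From HB Require Import structures.
From mathcomp Require Export all_boot all_order all_algebra.
From mathcomp Require Export all_classical all_reals all_analysis.
Export Order.TTheory GRing.Theory Num.Theory numFieldNormedType.Exports.

Set Implicit Arguments.
Unset Strict Implicit.
Unset Printing Implicit Defensive.

Local Open Scope classical_set_scope.
Local Open Scope ring_scope.

Definition Gamma (R : realType) (x : R) : R :=
  \int[lebesgue_measure]_(s in `]0%R, +oo[) (s `^ (x - 1) * expR (- s)).

(* Difference quotients are restricted to A: for A = ]0, h], this is the
   ordinary derivative in the interior and the left derivative at h. *)
Definition diff_quot (R : realType) (g : R -> R) (t s : R) : R :=
  (g s - g t) / (s - t).

Definition derivable_in (R : realType) (A : set R) (g : R -> R) (t : R) : Prop :=
  cvg (diff_quot g t s @[s --> within A t^']).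

Definition derive_in (R : realType) (A : set R) (g : R -> R) (t : R) : R :=
  lim (diff_quot g t s @[s --> within A t^']).

Section Substantial.
Variables (R : realType) (sigma rho h : R).
Implicit Types (g psi : R -> R) (gamma alpha t : R) (n m k : nat).

(* All operators act on functions whose domain is [0, h] or ]0, h]; values
   outside the domain are irrelevant. Differential operators are taken
   on ]0, h]. *)
Definition Dsub1 g : R -> R := fun t =>
  t `^ (1 - rho) / rho * derive_in `]0, h] g t + sigma * g t.

Definition Dsub n g : R -> R := iter n Dsub1 g.

(* At t, each of the n successive derivatives in Dsub n g exists. *)
Definition Dsub_exists n g t : Prop :=
  forall j, (j < n)%N -> derivable_in `]0, h] (Dsub j g) t.

Definition Dsub_at0 k psi : R := lim (Dsub k psi t @[t --> 0^'+]).

Definition Dsub_at0_exists k psi : Prop :=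
  (\forall t \near 0^'+, Dsub_exists k psi t) /\
  cvg (Dsub k psi t @[t --> 0^'+]).

Definition Isub_integrand gamma psi t : R -> R := fun s =>
  (t `^ rho - s `^ rho) `^ (gamma - 1)
  * expR (- sigma * (t `^ rho - s `^ rho))
  * s `^ (rho - 1) * psi s.

Definition Isub gamma psi : R -> R := fun t =>
  if gamma == 0 then psi t
  else rho / Gamma gamma
       * \int[lebesgue_measure]_(s in `[0%R, t]) Isub_integrand gamma psi t s.

Definition Isub_exists gamma psi t : Prop :=
  gamma = 0 \/
  lebesgue_measure.-integrable `[0%R, t] (EFin \o Isub_integrand gamma psi t).

(* In the following, m is the integer with m - 1 < alpha <= m. *)
Definition Dfrac alpha m psi : R -> R := Dsub m (Isub (m%:R - alpha) psi).

(* The nested operators make sense on all of ]0, h]. *)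
Definition Dfrac_exists alpha m psi : Prop :=
  forall t, t \in `]0, h] ->
    Isub_exists (m%:R - alpha) psi t /\
    Dsub_exists m (Isub (m%:R - alpha) psi) t.

Definition caputo_corr m psi : R -> R := fun t =>
  psi t - \sum_(k < m) Dsub_at0 k psi / k`!%:R * t `^ (rho * k%:R)
                       * expR (- sigma * t `^ rho).

Definition caputo alpha m psi : R -> R := Dfrac alpha m (caputo_corr m psi).

Definition caputo_exists alpha m psi : Prop :=
  (forall k, (k < m)%N -> Dsub_at0_exists k psi) /\
  Dfrac_exists alpha m (caputo_corr m psi).

(* The domain of f (and hence the range allowed for solutions) is given by H;
   values of f outside H are irrelevant. *)
Definition is_solution alpha m (H : set (R * R)) (f : R * R -> R)
    (c : 'I_m -> R) psi : Prop :=
  [/\ {within `[0, h], continuous psi},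
      forall t, t \in `[0, h] -> H (t, psi t),
      caputo_exists alpha m psi,
      forall t, t \in `]0, h] -> caputo alpha m psi t = f (t, psi t)
    & forall k : 'I_m, Dsub_at0 k psi = c k].

(* Uniqueness is as functions on [0, h]. *)
Definition solution_defined alpha m (H : set (R * R)) (f : R * R -> R)
    (c : 'I_m -> R) : Prop :=
  exists2 psi, is_solution alpha H f c psi
    & forall psi', is_solution alpha H f c psi' -> {in `[0, h], psi' =1 psi}.

End Substantial.

Definition Hset (R : realType) (sigma rho hstar K : R) (m : nat)
    (b : 'I_m -> R) : set (R * R) :=
  [set p | 0 <= p.1 <= hstar /\
     `|p.2 - expR (- sigma * p.1 `^ rho)
             * \sum_(k < m) b k / Gamma (k%:R + 1) * p.1 `^ (rho * k%:R)| <= K].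

(* Main.v *)
Require Import Defs.
From mathcomp Require Import ring lra measurable_realfun.

(** Write u = t^rho for the clock of the problem and multiply every function
    by exp (sigma * u). The operator t^(1-rho)/rho d/dt + sigma then becomes
    the derivative d/du, and the substantial integral of order a becomes
    1 / Gamma a times the Riemann-Liouville integral
      J^a g (t) = int_0^t (t^rho - s^rho)^(a-1) rho s^(rho-1) g(s) ds.
    With m = ceil alpha, the initial value problem is therefore equivalent to
    the Volterra equation
      exp (sigma u) psi(t) = sum_(k < m) c_k u^k / k! + c0 J^alpha F (t),
      F(s) = exp (sigma s^rho) f (s, psi(s)),
    for a constant c0 > 0 that depends on alpha only, and for small h the
    right-hand side is a contraction.

    The integrals compose up to a Beta constant, J^a J^b = B(a, b) J^(a+b)
    (RLint_semigroup): Tonelli's theorem reduces this to one integral, which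
    the substitution x = (s^rho - r^rho) / (t^rho - r^rho) turns into the Beta
    integral (kernel_conv). Hence J^(m-alpha) J^alpha is a positive multiple of
    the m-th iterate of J^1, which is m-fold integration in the clock, and c0
    is the constant that makes the two sides equal after the division by
    Gamma (m - alpha) (fracint_inverse). Leaving c0 as
    this product of constants avoids the relation between Beta and Gamma; the
    argument rests on 0 < Gamma (m - alpha).

    A solution of the Volterra equation solves the problem
    (volterra_solution), because J^(m-alpha) maps the remainder of psi beyond
    its initial polynomial to the m-th iterate of J^1 at F, whose m-th
    derivative in the clock is F. Conversely (solution_volterra), integrating
    the differential equation m times determines J^(m-alpha) of the remainder
    up to a polynomial of degree < m in u. The initial conditions make the
    remainder o(u^(m-1)), so that this polynomial vanishes (poly_small_eq0),
    and J^(m-alpha) is injective because J^(1-m+alpha) completes it to J^1,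
    which can be differentiated (fracint_inj).

    For existence, f is extended to all y by clipping y to the tube H, which
    keeps its bound and its Lipschitz constant; Picard iteration
    (halving_fixed_point) solves the extended equation. At t = 0 the initial
    polynomial with data c is within eps of the centre of the tube, since
    Gamma 1 = 1, so for eps and h small the solution does not leave the tube
    and the clipping is harmless. Finally, subtracting the equations of two
    solutions gives sup |psi - phi| <= m eps + sup |psi - phi| / 2
    (volterra_stable), which is the estimate with C = 2 m, and uniqueness when
    eps = 0. *)

Set Implicit Arguments.
Unset Strict Implicit.
Unset Printing Implicit Defensive.

Local Open Scope classical_set_scope.
Local Open Scope ring_scope.

(** * Substitution on an open interval *)
Section Substitution.
Context {R : realType}.
Notation mu := (@lebesgue_measure R).

(** The derivative of F may be unbounded, and G undefined, at the end points:
    this is what the singular kernels need. Exhaust ]a, b[ by compact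
    intervals, on which continuous substitution applies, and pass to the limit
    by monotone convergence. *)
Lemma ge0_integral_subst_oo (F f G : R -> R) (a b : R) : a < b ->
  {in `[a, b] &, {homo F : x y / x < y}} ->
  {within `[a, b], continuous F} ->
  (forall x, x \in `]a, b[ -> is_derive x 1 F (f x)) ->
  {in `]a, b[, continuous f} ->
  {in `]F a, F b[, continuous G} ->
  {in `]F a, F b[, forall y, 0 <= G y} ->
  (\int[mu]_(y in `]F a, F b[) (G y)%:E =
   \int[mu]_(x in `]a, b[) (G (F x) * f x)%:E)%E.
Proof.
move=> ab homoF cF dF cf cG G0.
(* dividing by n + 3 keeps a + e n < b - e n for every n *)
pose e (n : nat) : R := (b - a) / n.+3%:R.
have e0 n : 0 < e n by rewrite divr_gt0// subr_gt0.
have e3 n : e n * 3 <= b - a.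
  by rewrite mulrAC ler_pdivrMr// ler_pM2l ?subr_gt0// ler_nat.
have ende n m : (n <= m)%N -> e m <= e n.
  by move=> nm; rewrite ler_pM2l ?subr_gt0// lef_pV2 ?posrE// ler_nat.
have Fmono : {in `[a, b] &, {mono F : x y / x <= y}} by exact: le_mono_in.
pose X n : set R := `[a + e n, b - e n]%classic.
pose Y n : set R := `[F (a + e n), F (b - e n)]%classic.
have ain n : a + e n \in `]a, b[ by rewrite in_itv/=; have := e0 n; have := e3 n; lra.
have bin n : b - e n \in `]a, b[ by rewrite in_itv/=; have := e0 n; have := e3 n; lra.
have oc x : x \in `]a, b[ -> x \in `[a, b] by exact: subset_itv_oo_cc.
have acc : a \in `[a, b] by rewrite in_itv/= lexx ltW.
have bcc : b \in `[a, b] by rewrite in_itv/= lexx ltW.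
have Xoo n x : X n x -> x \in `]a, b[.
  by rewrite /X/= !in_itv/=; have := e0 n; lra.
have Foo x : x \in `]a, b[ -> F x \in `]F a, F b[.
  move=> xab; rewrite in_itv/= !homoF ?(itvP xab)//; exact: oc.
have Yoo n y : Y n y -> y \in `]F a, F b[.
  rewrite /Y/= !in_itv/=.
  have := Foo _ (ain n); have := Foo _ (bin n); rewrite !in_itv/= => /andP[_ h1] /andP[h2 _].
  by move=> /andP[h3 h4]; rewrite (lt_le_trans h2)//= (le_lt_trans h4).
have UX : \bigcup_n X n = `]a, b[%classic.
  apply/seteqP; split => x; first by move=> [n _ /Xoo].
  rewrite /= in_itv/= => /andP[ax xb].
  have d0 : 0 < Num.min (x - a) (b - x) by rewrite lt_min !subr_gt0 ax xb.
  have [n hn] : exists n, e n <= Num.min (x - a) (b - x).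
    exists (Num.truncn ((b - a) / Num.min (x - a) (b - x))).
    rewrite /e ler_pdivrMr// mulrC -ler_pdivrMr// ltW//.
    by rewrite (lt_le_trans (truncnS_gt _))// ler_nat ltnS leqW.
  exists n => //; rewrite /X/= in_itv/=; move: hn; rewrite le_min; lra.
have UY : \bigcup_n Y n = `]F a, F b[%classic.
  apply/seteqP; split => y; first by move=> [n _ /Yoo].
  rewrite /= in_itv/= => /andP[Fay yFb].
  have [x xab Fx] : exists2 x, x \in `[a, b] & F x = y.
    apply: (IVT (ltW ab) cF).
    by rewrite ge_min le_max (ltW Fay) (ltW yFb) orbT.
  have xoo : x \in `]a, b[.
    rewrite in_itv/= !lt_neqAle !(itvP xab) !andbT; apply/andP; split.
      by apply/eqP => h; move: Fay; rewrite -Fx h ltxx.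
    by apply/eqP => h; move: yFb; rewrite -Fx h ltxx.
  have : (`]a, b[%classic : set R) x by [].
  rewrite -UX => -[n _ Xnx]; exists n => //.
  have := Xnx; rewrite /X/Y/= !in_itv/= -Fx => /andP[h1 h2].
  by rewrite !Fmono ?h1 ?h2//; exact: oc.
have ndX : nondecreasing_seq X.
  move=> n m /ende nm; apply/subsetPset => x.
  by rewrite /X/= !in_itv/=; lra.
have ndY : nondecreasing_seq Y.
  move=> n m /ende nm; apply/subsetPset => y; rewrite /Y/= !in_itv/= => /andP[h1 h2].
  apply/andP; split.
    by apply: le_trans h1; rewrite Fmono ?oc//; lra.
  by apply: (le_trans h2); rewrite Fmono ?oc//; lra.
have FE x : x \in `]a, b[ -> F^`()%classic x = f x.
  by move=> xab; rewrite derive1E; have := dF _ xab => ?; rewrite derive_val.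
have cFx x : x \in `]a, b[ -> {for x, continuous F}.
  move=> /dF [df _]; apply: differentiable_continuous; exact/derivable1_diffP.
have cgf : {in `]a, b[, continuous (fun x => G (F x) * f x)}.
  move=> x xab; apply: cvgM; last exact: cf.
  by apply: (@continuous_comp _ _ _ F G); [exact: cFx|exact/cG/Foo].
have mgf : measurable_fun `]a, b[ (fun x => G (F x) * f x).
  apply: subspace_continuous_measurable_fun => //.
  exact: continuous_subspace_itv.
have mG : measurable_fun `]F a, F b[ G.
  apply: subspace_continuous_measurable_fun => //.
  exact: continuous_subspace_itv.
have f0 x : x \in `]a, b[ -> 0 <= f x.
  move=> xab; rewrite -FE//; apply: (@incr_derive1_ge0_itv _ F true false a b) => //.
  by move=> z; rewrite inE/= => /dF[].
have eqn n : (\int[mu]_(y in Y n) (G y)%:E = \int[mu]_(x in X n) (G (F x) * f x)%:E)%E.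
  have le12 : a + e n < b - e n by have := e0 n; have := e3 n; lra.
  have sub x : x \in `[a + e n, b - e n] -> x \in `]a, b[.
    by move=> h; apply: (Xoo n).
  have subo x : x \in `]a + e n, b - e n[ -> x \in `]a, b[.
    by move=> h; apply: sub; exact: subset_itv_oo_cc h.
  have nearE x : x \in `]a, b[ -> F^`()%classic y @[y --> x] --> f x.
    move=> xab; apply: (cvg_trans _ (cf _ xab)); apply: near_eq_cvg.
    have := near_in_itvoo xab; apply: filterS => z zab.
    by rewrite FE.
  rewrite integration_by_substitution_increasing ?(ltW le12)//.
  - apply: eq_integral => x; rewrite inE/= => /sub xab.
    by rewrite -[X in X%:E]/(G (F x) * F^`()%classic x) FE.
  - move=> x y /sub/oc xab /sub/oc yab; exact: homoF.
  - move=> x /subo xab; rewrite /continuous_at FE//; exact: nearE.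
  - apply/cvg_ex; exists (f (a + e n)); apply: cvg_at_right_filter; exact: nearE.
  - apply/cvg_ex; exists (f (b - e n)); apply: cvg_at_left_filter; exact: nearE.
  - split.
    + by move=> x /subo/dF[].
    + by apply: cvg_at_right_filter; exact: cFx.
    + by apply: cvg_at_left_filter; exact: cFx.
  - apply: continuous_subspace_itv => y yY; apply: cG; exact: (Yoo n).
rewrite -UX -UY.
apply: (@cvg_unique _ _ (fmap (fun n => \int[mu]_(y in Y n) (G y)%:E)%E \oo)).
- exact: ereal_hausdorff.
- apply: ge0_nondecreasing_set_cvg_integral => //.
  + by move=> n; apply: measurable_itv.
  + move=> n; apply/measurable_EFinP; apply: measurable_funS mG => //.
    by move=> y /Yoo.
  + by move=> n y /Yoo yY; rewrite lee_fin G0.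
- rewrite [X in fmap X](_ : _ = (fun n => \int[mu]_(x in X n) (G (F x) * f x)%:E)%E); last first.
    by apply/funext => n; exact: eqn.
  apply: ge0_nondecreasing_set_cvg_integral => //.
  + by move=> n; apply: measurable_itv.
  + move=> n; apply/measurable_EFinP; apply: measurable_funS mgf => //.
    by move=> x /Xoo.
  + by move=> n x /Xoo xX; rewrite lee_fin mulr_ge0 ?f0//; exact/G0/Foo.
Qed.

End Substitution.

(** * Continuity and monotonicity of real powers *)
Lemma continuous_comp_within (T U V : topologicalType) (A : set U)
    (f : U -> V) (g : T -> U) :
  {within A, continuous f} -> continuous g -> (forall x, A (g x)) ->
  continuous (f \o g).
Proof.
move=> /subspace_continuousP cf cg Ag x.
apply: (@cvg_comp _ _ _ g f _ (within A (nbhs (g x)))); last exact: cf.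
move=> P AP; have := cg x _ AP; rewrite /nbhs/=; apply: filterS => z; exact.
Qed.

Section PowerFunctions.
Context {R : realType}.
Implicit Types a b c p x y : R.

Lemma continuous_powR p x : 0 < x -> {for x, continuous (@powR R ^~ p)}.
Proof.
move=> x0; apply: differentiable_continuous; apply/derivable1_diffP.
by apply: derivable_powR; rewrite in_itv/= x0.
Qed.

Lemma within_continuous_powR p : 0 < p ->
  {within `[0, +oo[, continuous (@powR R ^~ p)}.
Proof.
move=> p0; apply/continuous_within_itvcyP; split.
  by move=> x; rewrite in_itv/= andbT; exact: continuous_powR.
by rewrite powR0 ?gt_eqF//; exact: powR_cvg0.
Qed.

Lemma within_continuous_powR_itv p a b : 0 < p -> 0 <= a ->
  {within `[a, b], continuous (@powR R ^~ p)}.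
Proof.
move=> p0 a0; apply: continuous_subspaceW (within_continuous_powR p0).
by move=> x/=; rewrite !in_itv/= andbT => /andP[ax _]; exact: le_trans ax.
Qed.

Lemma continuous_max0_powR p : 0 < p ->
  continuous (fun x : R => Num.max 0 x `^ p).
Proof.
move=> p0.
apply: (@continuous_comp_within R R R `[0, +oo[%classic (@powR R ^~ p) (Num.max 0)).
- exact: within_continuous_powR.
- by move=> x; apply: continuous_max; [exact: cvg_cst|exact: cvg_id].
- by move=> x; rewrite /= in_itv/= andbT le_max lexx.
Qed.

Lemma ltr_powR p x y : 0 < p -> 0 <= x -> x < y -> x `^ p < y `^ p.
Proof.
move=> p0 x0 xy; apply: gt0_ltr_powR; rewrite ?nnegrE//.
by rewrite (le_trans x0) ?ltW.
Qed.

Lemma ler_powRl p x y : 0 <= p -> 0 <= x -> x <= y -> x `^ p <= y `^ p.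
Proof.
by move=> p0 x0 xy; apply: ge0_ler_powR; rewrite ?nnegrE// (le_trans x0).
Qed.

Lemma ler_powRl_neg p x y : p <= 0 -> 0 < x -> x <= y -> y `^ p <= x `^ p.
Proof.
move=> p0 x0 xy; have y0 : 0 < y by exact: lt_le_trans xy.
rewrite -[p]opprK !(powRN _ (- p)) lef_pV2 ?posrE ?powR_gt0//.
by apply: ler_powRl; rewrite ?oppr_ge0// ltW.
Qed.

Lemma powR_div p x y : 0 <= x -> 0 < y -> (x / y) `^ p = x `^ p / y `^ p.
Proof.
move=> x0 y0; rewrite powRM ?invr_ge0 ?(ltW y0)//; congr (_ * _).
by rewrite -powR_inv1 ?(ltW y0)// -powRrM mulN1r powRN.
Qed.

(** The two terms on the right are for 0 <= p and for p < 0. *)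
Lemma powR_half_le p x : 2^-1 <= x -> x <= 1 -> x `^ p <= 1 + 2^-1 `^ p.
Proof.
move=> x2 x1; have h0 : 0 < 2^-1 :> R by rewrite invr_gt0.
have x0 : 0 < x by exact: lt_le_trans x2.
have [p0|p0] := leP 0 p.
  rewrite (@le_trans _ _ 1) ?lerDl ?powR_ge0//.
  by have := ler_powRl p0 (ltW x0) x1; rewrite powR1.
rewrite (@le_trans _ _ (2^-1 `^ p)) ?lerDr ?ler01//.
exact: ler_powRl_neg (ltW p0) h0 x2.
Qed.

Lemma measurable_powR_itv p a b : measurable_fun `]a, b[ (@powR R ^~ p).
Proof. by apply: measurable_funTS; exact: measurable_powR. Qed.

End PowerFunctions.

(** * The Beta integral *)
Section BetaIntegral.
Context {R : realType}.
Implicit Types a b r t : R.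
Notation mu := (@lebesgue_measure R).

Definition beta_integrand a b (x : R) := (1 - x) `^ (a - 1) * x `^ (b - 1).

Definition Beta a b : R := \int[mu]_(x in `]0, 1[) beta_integrand a b x.

Lemma measurable_beta_integrand a b : measurable_fun setT (beta_integrand a b).
Proof.
apply: measurable_funM; last exact: measurable_powR.
apply: (measurableT_comp (measurable_powR _)).
exact: measurable_funB.
Qed.

Let mu01 : mu (`]0%R, 1%R[%classic : set R) = 1%E.
Proof. by rewrite lebesgue_measure_itv/= lte_fin ltr01 oppr0 adde0. Qed.

(** Substituting y = x^b in the integral of 1 evaluates this improper integral
    without a limit argument. *)
Lemma integral_powR01 b : 0 < b ->
  (\int[mu]_(x in `]0%R, 1%R[) (x `^ (b - 1))%:E = b^-1%:E)%E.
Proof.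
move=> b0.
have cst1 : (\int[mu]_(y in `]0%R, 1%R[) 1%:E = 1 :> \bar R)%E.
  by rewrite integral_cst// mul1e; exact: mu01.
have /= := @ge0_integral_subst_oo R (@powR R ^~ b) (fun x => b * x `^ (b - 1)) (cst 1) 0 1 ltr01.
rewrite powR0 ?gt_eqF// powR1 cst1 => subst.
have {subst} : (1 = \int[mu]_(x in `]0%R, 1%R[) (1 * (b * x `^ (b - 1)))%:E)%E.
  apply: subst.
  - move=> x y; rewrite !in_itv/= => /andP[x0 _] _ xy; exact: ltr_powR.
  - exact: within_continuous_powR_itv.
  - move=> x; rewrite in_itv/= => /andP[x0 _]; exact: is_derive1_powR.
  - move=> x; rewrite in_itv/= => /andP[x0 _].
    by apply: cvgM; [exact: cvg_cst|exact: continuous_powR].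
  - by move=> x _; exact: cvg_cst.
  - by move=> x _; exact: ler01.
under eq_integral do rewrite mul1r EFinM.
rewrite ge0_integralZl_EFin//; last 3 first.
  by move=> x _; rewrite lee_fin powR_ge0.
  by apply/measurable_EFinP; exact: measurable_powR_itv.
  exact: ltW.
move=> /(congr1 (fun z => (b^-1%:E * z)%E)).
by rewrite mule1 muleA -EFinM mulVf ?gt_eqF// mul1e => ->.
Qed.

Lemma is_derive_onem_powR a (x : R) : x < 1 ->
  is_derive x 1 (fun x : R => 1 - (1 - x) `^ a) (a * (1 - x) `^ (a - 1)).
Proof.
move=> x1; have x0 : 0 < 1 - x by rewrite subr_gt0.
have dp := is_derive1_powR a x0.
have d1 : is_derive x 1 (fun x : R => 1 - x) (- 1).
  by have := is_deriveB (is_derive_cst (1 : R) x 1) (is_derive_id x 1); rewrite sub0r.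
have := @is_derive1_comp _ (@powR R ^~ a) (fun x : R => 1 - x) x _ _ dp d1.
move=> dc; have := is_deriveB (is_derive_cst (1 : R) x 1) dc.
by move=> /trigger_derive; apply; ring.
Qed.

Lemma integral_powR01_onem a : 0 < a ->
  (\int[mu]_(x in `]0%R, 1%R[) ((1 - x) `^ (a - 1))%:E = a^-1%:E)%E.
Proof.
move=> a0.
have cst1 : (\int[mu]_(y in `]0%R, 1%R[) 1%:E = 1 :> \bar R)%E.
  by rewrite integral_cst// mul1e; exact: mu01.
have := @ge0_integral_subst_oo R (fun x => 1 - (1 - x) `^ a)
  (fun x => a * (1 - x) `^ (a - 1)) (cst 1) 0 1 ltr01.
rewrite /= subr0 powR1 !subrr powR0 ?gt_eqF// subr0 cst1 => subst.
have {subst} : (1 = \int[mu]_(x in `]0%R, 1%R[) (1 * (a * (1 - x) `^ (a - 1)))%:E)%E.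
  apply: subst.
  - move=> x y; rewrite !in_itv/= => /andP[x0 x1] /andP[y0 y1] xy.
    by rewrite ltrD2l ltrN2 ltr_powR//; lra.
  - apply: (@subspace_eq_continuous _ _ _ (fun x : R => 1 - Num.max 0 (1 - x) `^ a)).
      move=> x; rewrite inE/= in_itv/= => /andP[_ x1].
      by rewrite max_r// subr_ge0.
    apply: continuous_subspaceT => x; apply: cvgB; first exact: cvg_cst.
    apply: (@continuous_comp _ _ _ (fun x : R => 1 - x) (fun x : R => Num.max 0 x `^ a)).
      by apply: cvgB; [exact: cvg_cst|exact: cvg_id].
    exact: continuous_max0_powR.
  - by move=> x; rewrite in_itv/= => /andP[_ /(is_derive_onem_powR a)].
  - move=> x; rewrite in_itv/= => /andP[x0 x1].
    apply: cvgM; first exact: cvg_cst.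
    apply: (@continuous_comp _ _ _ (fun x : R => 1 - x) (@powR R ^~ (a - 1))).
      by apply: cvgB; [exact: cvg_cst|exact: cvg_id].
    by apply: continuous_powR; rewrite subr_gt0.
  - by move=> x _; exact: cvg_cst.
  - by move=> x _; exact: ler01.
under eq_integral do rewrite mul1r EFinM.
rewrite ge0_integralZl_EFin//; last 3 first.
  by move=> x _; rewrite lee_fin powR_ge0.
  apply/measurable_EFinP/(measurableT_comp (measurable_powR _)).
  exact: measurable_funB.
  exact: ltW.
move=> /(congr1 (fun z => (a^-1%:E * z)%E)).
by rewrite mule1 muleA -EFinM mulVf ?gt_eqF// mul1e => ->.
Qed.

(** On each half of ]0, 1[ one of the two factors is bounded, so that the
    integrand is dominated by a multiple of the sum of the two powers. *)
Lemma integrable_beta a b : 0 < a -> 0 < b ->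
  mu.-integrable `]0, 1[ (EFin \o beta_integrand a b).
Proof.
move=> a0 b0.
pose C : R := 1 + 2^-1 `^ (a - 1) + 2^-1 `^ (b - 1).
have Ca : 1 + 2^-1 `^ (a - 1) <= C by rewrite lerDl powR_ge0.
have Cb : 1 + 2^-1 `^ (b - 1) <= C by rewrite /C addrAC lerDl powR_ge0.
have C0 : 0 <= C by rewrite !addr_ge0 ?powR_ge0.
pose g x := C * ((1 - x) `^ (a - 1) + x `^ (b - 1)).
have m1 : measurable_fun (`]0, 1[%classic : set R) (fun x : R => (1 - x) `^ (a - 1)).
  apply: (measurableT_comp (measurable_powR _)); exact: measurable_funB.
have m2 := @measurable_powR_itv R (b - 1) 0 1.
apply: (@le_integrable _ _ _ mu _ _ _ (EFin \o g)) => //.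
- by apply/measurable_EFinP; apply: measurable_funTS; exact: measurable_beta_integrand.
- move=> x /=; rewrite in_itv/= => /andP[x0 x1].
  rewrite !ger0_norm ?lee_fin; last 2 first.
    by rewrite mulr_ge0// addr_ge0 ?powR_ge0.
    by rewrite mulr_ge0 ?powR_ge0.
  rewrite /g/beta_integrand mulrDr.
  have [x2|x2] := leP x 2^-1.
    rewrite (@le_trans _ _ (C * x `^ (b - 1)))// ?lerDr ?mulr_ge0 ?powR_ge0//.
    rewrite ler_wpM2r ?powR_ge0// (le_trans _ Ca)// powR_half_le//; lra.
  rewrite (@le_trans _ _ (C * (1 - x) `^ (a - 1)))// ?lerDl ?mulr_ge0 ?powR_ge0//.
  rewrite mulrC ler_wpM2r ?powR_ge0// (le_trans _ Cb)// powR_half_le//; lra.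
- pose g1 (x : R) := (1 - x) `^ (a - 1); pose g2 (x : R) := x `^ (b - 1).
  rewrite (_ : EFin \o g = (fun x => C%:E * ((EFin \o g1) x + (EFin \o g2) x))%E) //.
  apply: integrableZl => //; apply: integrableD => //; apply/integrableP; split.
  + exact/measurable_EFinP.
  + under eq_integral do rewrite /= ger0_norm ?powR_ge0//.
    by rewrite integral_powR01_onem// ltry.
  + exact/measurable_EFinP.
  + under eq_integral do rewrite /= ger0_norm ?powR_ge0//.
    by rewrite integral_powR01// ltry.
Qed.

Lemma EFin_Beta a b : 0 < a -> 0 < b ->
  (Beta a b)%:E = (\int[mu]_(x in `]0%R, 1%R[) (beta_integrand a b x)%:E)%E.
Proof.
by move=> a0 b0; rewrite /Beta /Rintegral fineK// integrable_fin_num//; exact: integrable_beta.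
Qed.

Lemma Rintegral_gt0_on01 (D : set R) (f : R -> R) : measurable D -> `]0, 1[ `<=` D ->
  mu.-integrable D (EFin \o f) -> (forall x, D x -> 0 <= f x) ->
  (forall x, x \in `]0, 1[ -> 0 < f x) -> 0 < \int[mu]_(x in D) f x.
Proof.
move=> mD D01 fi f0 fp.
have fne : mu.-integrable `]0, 1[ (EFin \o f) by exact: integrableS fi.
rewrite lt_neqAle Rintegral_ge0// andbT; apply/negP => /eqP int0.
have h : (\int[mu]_(x in D) `|(EFin \o f) x| = 0)%E.
  transitivity (\int[mu]_(x in D) (EFin \o f) x)%E.
    by apply: eq_integral => x; rewrite inE => Dx; rewrite /= ger0_norm ?f0.
  by rewrite -[LHS]fineK ?integrable_fin_num// -/(Rintegral mu D f) -int0.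
have mf : measurable_fun D (EFin \o f) by exact: (measurable_int _ fi).
have /(ae_eq_integral_abs mu mD mf)[N [mN N0 subN]] := h.
have : (mu (`]0%R, 1%R[%classic : set R) <= mu N)%E.
  apply: le_measure; rewrite ?inE//= => x x01; apply: subN => /= /(_ (D01 _ x01)) [] fx.
  by have := fp _ x01; rewrite fx ltxx.
by rewrite mu01 N0 lee_fin ler10.
Qed.

Lemma Beta_ge0 a b : 0 <= Beta a b.
Proof. by apply: Rintegral_ge0 => x _; rewrite mulr_ge0 ?powR_ge0. Qed.

Lemma Beta_gt0 a b : 0 < a -> 0 < b -> 0 < Beta a b.
Proof.
move=> a0 b0; apply: Rintegral_gt0_on01 => //; first exact: integrable_beta.
- by move=> x _; rewrite mulr_ge0 ?powR_ge0.
- by move=> x; rewrite in_itv/= => /andP[x0 x1]; rewrite mulr_gt0 ?powR_gt0 ?subr_gt0.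
Qed.

End BetaIntegral.

(** * The power kernel in the clock t^rho *)
Section Kernel.
Context {R : realType}.
Variable rho : R.
Hypothesis hrho : 0 < rho.
Implicit Types a b r s t : R.
Notation mu := (@lebesgue_measure R).

Definition clock_weight s := rho * s `^ (rho - 1).
Definition clock_kernel a t s := (t `^ rho - s `^ rho) `^ (a - 1).

Notation wpow := clock_weight.
Notation kpow := clock_kernel.

Lemma wpow_ge0 s : 0 <= wpow s.
Proof. by rewrite mulr_ge0 ?powR_ge0// ltW. Qed.

Lemma wpow_gt0 s : 0 < s -> 0 < wpow s.
Proof. by move=> s0; rewrite mulr_gt0 ?powR_gt0. Qed.

Lemma kpow_ge0 a t s : 0 <= kpow a t s.
Proof. exact: powR_ge0. Qed.

Lemma kernel_ge0 a t s : 0 <= kpow a t s * wpow s.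
Proof. exact: mulr_ge0 (kpow_ge0 _ _ _) (wpow_ge0 _). Qed.

Lemma kpow1 t s : kpow 1 t s = 1.
Proof. by rewrite /kpow subrr powRr0. Qed.

Lemma powR_rho_lt s t : 0 <= s -> s < t -> 0 < t `^ rho - s `^ rho.
Proof. by move=> s0 st; rewrite subr_gt0 ltr_powR. Qed.

(** The substitution x = (s^rho - r^rho) / (t^rho - r^rho) maps ]r, t[ onto
    ]0, 1[ and turns the integrand into a power of t^rho - r^rho times the Beta
    integrand. *)
Lemma kernel_conv a b r t : 0 < a -> 0 < b -> 0 <= r -> r < t ->
  (\int[mu]_(s in `]r, t[) (kpow a t s * kpow b s r * wpow s)%:E =
   (Beta a b * (t `^ rho - r `^ rho) `^ (a + b - 1))%:E)%E.
Proof.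
move=> a0 b0 r0 rt; set D := t `^ rho - r `^ rho.
have D0 : 0 < D by exact: powR_rho_lt.
have t0 : 0 < t by exact: le_lt_trans rt.
pose F s := (s `^ rho - r `^ rho) / D.
have Fr : F r = 0 by rewrite /F subrr mul0r.
have Ft : F t = 1 by rewrite /F divff ?gt_eqF.
have gt0 s : s \in `]r, t[ -> 0 < s.
  by rewrite in_itv/= => /andP[rs _]; exact: le_lt_trans rs.
have := @ge0_integral_subst_oo R F (fun s => wpow s / D) (beta_integrand a b) r t rt.
rewrite Fr Ft -EFin_Beta// => subst.
have {subst} : ((Beta a b)%:E = \int[mu]_(s in `]r, t[) (beta_integrand a b (F s) * (wpow s / D))%:E)%E.
  apply: subst.
  - move=> x y; rewrite !in_itv/= => /andP[x0 _] _ xy.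
    rewrite ltr_pM2r ?invr_gt0// ltrD2r ltr_powR// (le_trans r0)//.
  - have c := within_continuous_powR_itv (b := t) hrho r0.
    move=> x; apply: cvgM; last exact: cvg_cst.
    by apply: cvgB; [exact: c|exact: cvg_cst].
  - move=> s /gt0 s0.
    have dp := is_derive1_powR rho s0.
    have := is_deriveM (is_deriveB dp (is_derive_cst (r `^ rho) s 1)) (is_derive_cst (D^-1) s 1).
    move=> /trigger_derive; apply.
    by rewrite scaler0 add0r subr0 /wpow/= /GRing.scale/= mulrC.
  - move=> s /gt0 s0; apply: cvgM; last exact: cvg_cst.
    by apply: cvgM; [exact: cvg_cst|exact: continuous_powR].
  - move=> x; rewrite in_itv/= => /andP[x0 x1]; apply: cvgM; last exact: continuous_powR.
    apply: (@continuous_comp _ _ _ (fun x : R => 1 - x) (@powR R ^~ (a - 1))).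
      by apply: cvgB; [exact: cvg_cst|exact: cvg_id].
    by apply: continuous_powR; rewrite subr_gt0.
  - by move=> x _; rewrite mulr_ge0 ?powR_ge0.
rewrite (mulrC (Beta a b)) EFinM => ->.
rewrite -ge0_integralZl_EFin ?powR_ge0//; last 2 first.
- by move=> s _; rewrite lee_fin mulr_ge0 ?divr_ge0 ?mulr_ge0 ?powR_ge0 ?ltW.
- apply/measurable_EFinP; apply: measurable_funTS; apply: measurable_funM.
    apply: (measurableT_comp (measurable_beta_integrand _ _)).
    apply: measurable_funM => //; apply: measurable_funB => //; exact: measurable_powR.
  apply: measurable_funM => //; apply: measurable_funM => //; exact: measurable_powR.
apply: eq_integral => s; rewrite inE/= => srt.
have s0 := gt0 _ srt; move: srt; rewrite in_itv/= => /andP[rs st].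
congr EFin; rewrite /kpow /beta_integrand.
have -> : 1 - F s = (t `^ rho - s `^ rho) / D.
  by rewrite -Ft /F -mulrBl; congr (_ / _); ring.
rewrite /F !powR_div// ?subr_ge0 ?ler_powRl ?(ltW hrho) ?(ltW rs) ?(ltW st) ?(ltW s0)//.
have -> : D `^ (a + b - 1) = D `^ (a - 1) * D `^ (b - 1) * D.
  rewrite -[X in _ * X]powRr1 ?ltW// -!powRD ?(gt_eqF D0) ?implybT//.
  by congr (_ `^ _); ring.
have aux (x y d p q w : R) : 0 < x -> 0 < y -> 0 < d ->
    p * q * w = x * y * d * (p / x * (q / y) * (w / d)).
  by move=> x0 y0 d0; field; rewrite !gt_eqF.
by apply: aux; rewrite ?powR_gt0.
Qed.

(** The case b = 1 of kernel_conv, in which the second kernel is constant. *)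
Lemma kernel_mass a r t : 0 < a -> 0 <= r -> r <= t ->
  (\int[mu]_(s in `]r, t[) (kpow a t s * wpow s)%:E =
   (Beta a 1 * (t `^ rho - r `^ rho) `^ a)%:E)%E.
Proof.
move=> a0 r0; rewrite le_eqVlt => /predU1P[<-|rt].
  by rewrite set_itvoo0 integral_set0 subrr powR0 ?gt_eqF// mulr0.
have := kernel_conv a0 ltr01 r0 rt; rewrite addrK => <-.
by apply: eq_integral => s _; rewrite kpow1 mulr1.
Qed.

Lemma measurable_kpow a t : measurable_fun setT (kpow a t).
Proof.
apply: (measurableT_comp (measurable_powR _)).
by apply: measurable_funB => //; exact: measurable_powR.
Qed.

Lemma measurable_wpow : measurable_fun setT wpow.
Proof. by apply: measurable_funM => //; exact: measurable_powR. Qed.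

Lemma integrable_kernel a r t : 0 < a -> 0 <= r -> r <= t ->
  mu.-integrable `]r, t[ (EFin \o (fun s => kpow a t s * wpow s)).
Proof.
move=> a0 r0 rt; apply/integrableP; split.
  apply/measurable_EFinP/measurable_funTS/measurable_funM; first exact: measurable_kpow.
  exact: measurable_wpow.
rewrite [X in (X < _)%E](_ : _ = (Beta a 1 * (t `^ rho - r `^ rho) `^ a)%:E) ?ltry//.
rewrite -kernel_mass//; apply: eq_integral => s _.
by rewrite /= ger0_norm// mulr_ge0 ?kpow_ge0 ?wpow_ge0.
Qed.

End Kernel.

(** * The fractional integral *)
Section FractionalIntegral.
Context {R : realType}.
Variable rho : R.
Hypothesis hrho : 0 < rho.
Implicit Types (a b r s t k M : R) (g : R -> R).
Notation mu := (@lebesgue_measure R).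
Notation kpow := (clock_kernel rho).
Notation wpow := (clock_weight rho).

(** The factor 1 / Gamma a of the Riemann-Liouville integral is left out, so
    that the composition rule has a Beta constant instead of a quotient of
    Gamma values. The open interval avoids the values of the kernel at 0
    and t. *)
Definition rl_integral a g t : R := \int[mu]_(s in `]0, t[) (kpow a t s * wpow s * g s).

Notation RLint := rl_integral.

Lemma continuous_bounded_itv g t : continuous g ->
  exists2 M : R, 0 <= M & forall s, 0 <= s <= t -> `|g s| <= M.
Proof.
move=> cg; have [t0|t0] := leP 0 t; last first.
  by exists 0 => // s /andP[s0 st]; have := le_lt_trans (le_trans s0 st) t0; rewrite ltxx.
have [|c _ h] := @EVT_max R (fun s => `|g s|) 0 t t0.
  by apply: continuous_subspaceT => x; apply: cvg_norm; exact: cg.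
exists `|g c| => // s s0t; apply: h; rewrite in_itv/=; exact: s0t.
Qed.

Lemma integrable_kernelM a r t g : 0 < a -> 0 <= r -> continuous g ->
  mu.-integrable `]r, t[ (EFin \o (fun s => kpow a t s * wpow s * g s)).
Proof.
move=> a0 r0 cg; have [rt|rt] := leP r t; last first.
  by rewrite set_itv_ge ?bnd_simp -?leNgt ?ltW//; exact: integrable_set0.
have [M M0 gM] := continuous_bounded_itv t cg.
have bg : [bounded g x | x in `]r, t[].
  exists M; split; first exact: num_real.
  move=> x Mx s /=; rewrite in_itv/= => /andP[rs st].
  by rewrite (le_trans _ (ltW Mx))// gM// (ltW st) (le_trans r0 (ltW rs)).
have mg : measurable_fun `]r, t[ g.
  by apply: measurable_funTS; exact: continuous_measurable_fun.
by have := @integrableMl _ _ R mu _ (measurable_itv _) _ _ (integrable_kernel hrho a0 r0 rt) mg bg; exact.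
Qed.

Lemma normr_kernelM_le a r t g M : 0 < a -> 0 <= r -> r <= t -> continuous g ->
  (forall s, r < s < t -> `|g s| <= M) ->
  `|\int[mu]_(s in `]r, t[) (kpow a t s * wpow s * g s)| <=
    M * (Beta a 1 * (t `^ rho - r `^ rho) `^ a).
Proof.
move=> a0 r0 rt cg gM.
have ig := integrable_kernelM t a0 r0 cg.
have ik := integrable_kernel hrho a0 r0 rt.
apply: (le_trans (le_normr_Rintegral _ ig)) => //.
have -> : Beta a 1 * (t `^ rho - r `^ rho) `^ a =
    \int[mu]_(s in `]r, t[) (kpow a t s * wpow s).
  by rewrite /Rintegral kernel_mass.
rewrite -RintegralZl//; apply: le_Rintegral => //.
- by have := integrable_norm ig.
- by have := @integrableZl _ _ R mu _ (measurable_itv _) M _ ik; exact.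
- move=> s /=; rewrite in_itv/= => rst.
  rewrite normrM ger0_norm ?kernel_ge0//.
  by rewrite mulrC ler_wpM2r ?gM// kernel_ge0.
Qed.

Lemma RLint_le0 a g t : t <= 0 -> RLint a g t = 0.
Proof.
by move=> t0; rewrite /RLint set_itv_ge ?Rintegral_set0// bnd_simp -leNgt.
Qed.

Lemma normr_RLint_le a g t M : 0 < a -> 0 <= t -> continuous g ->
  (forall s, 0 < s < t -> `|g s| <= M) ->
  `|RLint a g t| <= M * (Beta a 1 * (t `^ rho) `^ a).
Proof.
move=> a0 t0 cg gM; have := normr_kernelM_le a0 (lexx 0) t0 cg gM.
by rewrite powR0 ?gt_eqF// subr0.
Qed.

Lemma eq_RLint a g1 g2 t : (forall s, 0 < s < t -> g1 s = g2 s) ->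
  RLint a g1 t = RLint a g2 t.
Proof.
move=> g12; apply: eq_Rintegral => s; rewrite inE/= in_itv/= => st.
by rewrite g12.
Qed.

Lemma RLint_linear a k g1 g2 t : 0 < a -> continuous g1 -> continuous g2 ->
  RLint a (fun s => k * g1 s + g2 s) t = k * RLint a g1 t + RLint a g2 t.
Proof.
move=> a0 c1 c2.
have i1 := integrable_kernelM t a0 (lexx 0) c1.
have i2 := integrable_kernelM t a0 (lexx 0) c2.
rewrite /RLint -RintegralZl// -RintegralD//; last first.
  by have := @integrableZl _ _ R mu _ (measurable_itv _) k _ i1; exact.
by apply: eq_Rintegral => s _; rewrite mulrDr mulrCA.
Qed.

Lemma RLintZ a k g t : 0 < a -> continuous g ->
  RLint a (fun s => k * g s) t = k * RLint a g t.
Proof.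
move=> a0 cg; rewrite /RLint -RintegralZl//; last exact: integrable_kernelM.
by apply: eq_Rintegral => s _; rewrite mulrCA.
Qed.

Lemma kpow_ndecr a s r t : 1 <= a -> 0 < s -> s < r -> r <= t ->
  kpow a r s <= kpow a t s.
Proof.
move=> a1 s0 sr rt; apply: ler_powRl.
- by rewrite subr_ge0.
- by rewrite ltW// powR_rho_lt// ltW.
- by rewrite lerD2r ler_powRl ?(ltW hrho) ?(ltW (lt_trans s0 sr)).
Qed.

Lemma kpow_nincr a s r t : a <= 1 -> 0 < s -> s < r -> r <= t ->
  kpow a t s <= kpow a r s.
Proof.
move=> a1 s0 sr rt; apply: ler_powRl_neg.
- by rewrite subr_le0.
- by rewrite powR_rho_lt// ltW.
- by rewrite lerD2r ler_powRl ?(ltW hrho) ?(ltW (lt_trans s0 sr)).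
Qed.

(** Split the integral up to t at r. The piece over ]r, t[ is bounded by the mass of
    the kernel. Over ]0, r[ the difference of the two kernels has a constant
    sign (the kernel is monotone in t, increasing if 1 <= a and decreasing
    otherwise), so the integral of its absolute value is the absolute value of
    a difference of masses. *)
Lemma RLint_increment a g r t M : 0 < a -> 0 <= r -> r <= t -> continuous g ->
  (forall s, 0 <= s <= t -> `|g s| <= M) ->
  `|RLint a g t - RLint a g r| <= M * (Beta a 1 *
    ((t `^ rho - r `^ rho) `^ a *+ 2 + `|(t `^ rho) `^ a - (r `^ rho) `^ a|)).
Proof.
move=> a0 r0 rt cg gM.
have t0 : 0 <= t by exact: le_trans rt.
have M0 : 0 <= M by rewrite (le_trans _ (gM 0 _)) ?normr_ge0// lexx.
have split h : mu.-integrable `]0, t[ (EFin \o h) ->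
    \int[mu]_(s in `]0, t[) h s =
    \int[mu]_(s in `]0, r[) h s + \int[mu]_(s in `]r, t[) h s.
  move=> ih; have [rt'|] := ltP r t; last first.
    move=> tr; have -> : r = t by apply/le_anti; rewrite rt tr.
    by rewrite set_itvoo0 Rintegral_set0 addr0.
  rewrite (@Rintegral_itv_bndo_bndc _ (BRight 0) r); last first.
    by apply: integrableS ih => //; apply: subset_itvl; rewrite bnd_simp.
  by rewrite -(@Rintegral_itvB _ _ (BRight 0) (BLeft t) r) ?bnd_simp// addrC subrK.
have ig := integrable_kernelM t a0 (lexx 0) cg.
have igr := integrable_kernelM r a0 (lexx 0) cg.
have ik := integrable_kernel hrho a0 (lexx 0) t0.
have ikr := integrable_kernel hrho a0 (lexx 0) r0.
have sub0r : `]0, r[ `<=` `]0, t[ by apply: subset_itvl; rewrite bnd_simp.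
have ig' := @integrableS _ _ R mu _ _ _ (measurable_itv _) (measurable_itv _) sub0r ig.
have ik' := @integrableS _ _ R mu _ _ _ (measurable_itv _) (measurable_itv _) sub0r ik.
have mass x y : 0 <= x -> x <= y ->
    \int[mu]_(s in `]x, y[) (kpow a y s * wpow s) = Beta a 1 * (y `^ rho - x `^ rho) `^ a.
  by move=> x0 xy; rewrite /Rintegral kernel_mass.
have mass0 x : 0 <= x ->
    \int[mu]_(s in `]0, x[) (kpow a x s * wpow s) = Beta a 1 * (x `^ rho) `^ a.
  by move=> x0; rewrite mass// powR0 ?gt_eqF// subr0.
rewrite /RLint (split _ ig) addrAC -(@RintegralB _ _ R mu _ _ _ (measurable_itv _) ig' igr).
set I1 := \int[mu]_(_ in _) _; set I2 := \int[mu]_(_ in _) _.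
have I2le : `|I2| <= M * (Beta a 1 * (t `^ rho - r `^ rho) `^ a).
  apply: normr_kernelM_le => // s /andP[rs st].
  by apply: gM; rewrite (ltW st) (le_trans r0 (ltW rs)).
pose d s := kpow a t s * wpow s - kpow a r s * wpow s.
have id_ : mu.-integrable `]0, r[ (EFin \o d).
  by have := @integrableB _ _ R mu _ (measurable_itv _) _ _ ik' ikr; exact.
have dE : \int[mu]_(s in `]0, r[) d s =
    Beta a 1 * ((t `^ rho) `^ a - (r `^ rho) `^ a - (t `^ rho - r `^ rho) `^ a).
  pose A := \int[mu]_(s in `]0, r[) (kpow a t s * wpow s).
  have h : Beta a 1 * (t `^ rho) `^ a = A + Beta a 1 * (t `^ rho - r `^ rho) `^ a.
    by rewrite -(mass0 t t0) -(mass r t r0 rt); exact: (split _ ik).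
  have -> : \int[mu]_(s in `]0, r[) d s = A - Beta a 1 * (r `^ rho) `^ a.
    by rewrite -(mass0 r r0); exact: (@RintegralB _ _ R mu _ _ _ (measurable_itv _) ik' ikr).
  move: h; move: A (Beta a 1) (_ `^ a) (_ `^ a) (_ `^ a) => A B x y z h.
  by rewrite !mulrBr h; ring.
have dsgn : (forall s, `]0, r[%classic s -> 0 <= d s) \/ (forall s, `]0, r[%classic s -> d s <= 0).
  have [a1|a1] := leP 1 a; [left|right] => s /=; rewrite in_itv/= => /andP[s0 sr].
    by rewrite subr_ge0; apply: ler_wpM2r (wpow_ge0 hrho s) _ _ _; exact: kpow_ndecr.
  by rewrite subr_le0; apply: ler_wpM2r (wpow_ge0 hrho s) _ _ _; exact: kpow_nincr (ltW a1) _ _ _.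
have dnorm : \int[mu]_(s in `]0, r[) `|d s| = `|\int[mu]_(s in `]0, r[) d s|.
  case: dsgn => ds.
    rewrite ger0_norm ?Rintegral_ge0//; apply: eq_Rintegral => s; rewrite inE => sr.
    by rewrite ger0_norm ?ds.
  transitivity (\int[mu]_(s in `]0, r[) (-1 * d s)).
    apply: eq_Rintegral => s; rewrite inE => sr.
    by rewrite ler0_norm ?ds// mulN1r.
  rewrite (@RintegralZl _ _ R mu _ _ _ (measurable_itv _) id_) mulN1r ler0_norm//.
  rewrite -oppr_ge0 -mulN1r -(@RintegralZl _ _ R mu _ _ _ (measurable_itv _) id_).
  by apply: Rintegral_ge0 => s sr; rewrite mulN1r oppr_ge0 ds.
have I1le : `|I1| <= M * `|\int[mu]_(s in `]0, r[) d s|.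
  have ii : mu.-integrable `]0, r[ (EFin \o (fun s => kpow a t s * wpow s * g s
      - kpow a r s * wpow s * g s)).
    by have := @integrableB _ _ R mu _ (measurable_itv _) _ _ ig' igr; exact.
  have ind : mu.-integrable `]0, r[ (EFin \o (fun s => `|d s|)).
    by have := integrable_norm id_; exact.
  rewrite -dnorm (le_trans (@le_normr_Rintegral _ _ R mu _ _ (measurable_itv _) ii))//.
  rewrite -(@RintegralZl _ _ R mu _ _ _ (measurable_itv _) ind).
  apply: (@le_Rintegral _ _ R mu _ _ _ (measurable_itv _)).
  - by have := integrable_norm ii; exact.
  - by have := @integrableZl _ _ R mu _ (measurable_itv _) M _ ind; exact.
  - move=> s /=; rewrite in_itv/= => /andP[s0 sr].
    rewrite -mulrBl normrM mulrC ler_wpM2r//.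
    by apply: gM; rewrite (ltW s0) (le_trans (ltW sr)).
rewrite (le_trans (ler_normD _ _))// (le_trans (lerD I1le I2le))//.
rewrite dE normrM (ger0_norm (ltW (Beta_gt0 a0 ltr01))) -mulrDr -mulrDr.
rewrite ler_wpM2l// ler_wpM2l ?(ltW (Beta_gt0 _ _))//.
have h := ler_normB ((t `^ rho) `^ a - (r `^ rho) `^ a) ((t `^ rho - r `^ rho) `^ a).
rewrite (ger0_norm (powR_ge0 _ a)) in h.
by apply: (le_trans (lerD h (lexx _))); rewrite mulr2n -addrA addrC.
Qed.

End FractionalIntegral.

Section FractionalIntegralCalculus.
Context {R : realType}.
Variable rho : R.
Hypothesis hrho : 0 < rho.
Implicit Types (a b r s t k M : R) (g : R -> R).
Notation mu := (@lebesgue_measure R).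
Notation kpow := (clock_kernel rho).
Notation wpow := (clock_weight rho).
Notation RLint := (rl_integral rho).

Lemma RLint_max0 a g t : RLint a g t = RLint a g (Num.max 0 t).
Proof.
have [t0|t0] := leP t 0; last by [].
by rewrite !RLint_le0.
Qed.

(** The bound of RLint_increment is a continuous function of the end points
    that vanishes on the diagonal. The truncation at 0 covers t <= 0, where the
    integral is 0 but t `^ rho is not. *)
Lemma continuous_RLint a g : 0 < a -> continuous g -> continuous (RLint a g).
Proof.
move=> a0 cg x.
pose T := Num.max 0 (x + 1).
have [M M0 gM] := continuous_bounded_itv T cg.
pose th t := Num.max 0 t `^ rho.
have cth : continuous th by exact: continuous_max0_powR.
have th0 t : 0 <= th t by exact: powR_ge0.
pose bd t := M * (Beta a 1 * (Num.max 0 `|th x - th t| `^ a *+ 2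
   + `|Num.max 0 (th x) `^ a - Num.max 0 (th t) `^ a|)).
have bdP t : t <= x + 1 -> `|RLint a g x - RLint a g t| <= bd t.
  move=> tx1; have mle y : y <= x + 1 -> Num.max 0 y <= T.
    by move=> y1; rewrite /T ge_max !le_max lexx y1 orbT.
  have xx1 : x <= x + 1 by rewrite lerDl.
  rewrite (RLint_max0 a g x) (RLint_max0 a g t) /bd (max_r (normr_ge0 _)).
  rewrite (max_r (th0 x)) (max_r (th0 t)) /th.
  have m0 y : 0 <= Num.max 0 y :> R by rewrite le_max lexx.
  move: (Num.max 0 x) (Num.max 0 t) (mle _ xx1) (mle _ tx1) (m0 x) (m0 t) => y z yT zT y0 z0.
  have inc u v : 0 <= u -> u <= v -> v <= T ->
      `|RLint a g v - RLint a g u| <= M * (Beta a 1 * (`|v `^ rho - u `^ rho| `^ a *+ 2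
         + `|(v `^ rho) `^ a - (u `^ rho) `^ a|)).
    move=> u0 uv vT; rewrite (ger0_norm (_ : 0 <= v `^ rho - u `^ rho)); last first.
      by rewrite subr_ge0 ler_powRl// ltW.
    apply: (RLint_increment hrho a0 u0 uv cg) => s /andP[s0 sv].
    by rewrite gM// s0 (le_trans sv).
  have [zy|yz] := leP z y; first exact: inc.
  rewrite distrC [X in M * (_ * (X `^ _ *+ _ + _))]distrC.
  by rewrite [X in M * (_ * (_ + X))]distrC; apply: inc => //; exact: ltW.
have cbd : bd t @[t --> x] --> bd x.
  have ca : continuous (fun y : R => Num.max 0 y `^ a) by exact: continuous_max0_powR.
  apply: cvgM; first exact: cvg_cst.
  apply: cvgM; first exact: cvg_cst.
  apply: cvgD.
    apply: cvgMn.
    apply: (@cvg_comp _ _ _ (fun t => `|th x - th t|) (fun y => Num.max 0 y `^ a) _ (nbhs `|th x - th x|)); last exact: ca.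
    by apply: cvg_norm; apply: cvgB; [exact: cvg_cst|exact: cth].
  apply: cvg_norm; apply: cvgB; first exact: cvg_cst.
  apply: (@cvg_comp _ _ _ th (fun y => Num.max 0 y `^ a) _ (nbhs (th x))); last exact: ca.
  exact: cth.
have bdx : bd x = 0.
  by rewrite /bd !subrr normr0 maxxx powR0 ?gt_eqF// mul0rn addr0 !mulr0.
apply/cvgrPdist_lt => e e0; near=> t.
apply: (le_lt_trans (bdP t _)); first by near: t; apply: lt_le_nbhsl; rewrite ltrDl.
rewrite (le_lt_trans (ler_norm _))// -[X in `|X|]subr0 -bdx distrC.
by near: t; move/cvgrPdist_lt : cbd; apply.
Unshelve. all: end_near. Qed.

(** In the clock, J^1 is an antiderivative: its kernel is constant. *)
Lemma is_derive_RLint1 g t : 0 < t -> continuous g ->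
  is_derive t 1 (RLint 1 g) (wpow t * g t).
Proof.
move=> t0 cg.
have ig u : mu.-integrable `]0, u] (EFin \o (fun s => wpow s * g s)).
  apply: (@integrableS _ _ R mu `]0, u + 1[%classic) => //.
    by apply: subset_itvl; rewrite bnd_simp ltrDl.
  have := integrable_kernelM hrho (u + 1) (@ltr01 R) (lexx 0) cg.
  by apply: eq_integrable => // s _ /=; rewrite kpow1 mul1r.
have JE : RLint 1 g = fun x => \int[mu]_(s in `]0, x]) (wpow s * g s).
  apply/funext => x; rewrite -Rintegral_itv_bndo_bndc; last first.
    by apply: integrableS (ig x) => //; apply: subset_itvl; rewrite bnd_simp.
  by apply: eq_Rintegral => s _; rewrite kpow1 mul1r.
have t1 : t < t + 1 by rewrite ltrDl.
have cw : {for t, continuous (fun s => wpow s * g s)}.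
  apply: cvgM; last exact: cg.
  by apply: cvgM; [exact: cvg_cst|exact: continuous_powR].
have bt : (BRight 0 < BRight t)%O by rewrite bnd_simp.
have [d e] := continuous_FTC1 t1 (ig (t + 1)) bt cw.
by rewrite JE; split; [exact: d|rewrite -derive1E; exact: e].
Qed.

Lemma measurable_wpow_g g : continuous g -> measurable_fun setT (fun s => wpow s * g s).
Proof.
move=> cg; apply: measurable_funM; first exact: measurable_wpow.
exact: continuous_measurable_fun.
Qed.

(** Tonelli's theorem exchanges the two integrations; the inner integral is
    then the one of kernel_conv. *)
Lemma RLint_semigroup_ge0 a b g t : 0 < a -> 0 < b -> continuous g ->
  (forall s, 0 < s < t -> 0 <= g s) ->
  RLint a (RLint b g) t = Beta a b * RLint (a + b) g t.
Proof.
move=> a0 b0 cg g0.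
have ab0 : 0 < a + b by exact: addr_gt0.
have cJ := continuous_RLint b0 cg.
apply: EFin_inj; rewrite EFinM.
have EJ c h x : 0 < c -> continuous h ->
    (RLint c h x)%:E = (\int[mu]_(s in `]0%R, x[) (kpow c x s * wpow s * h s)%:E)%E.
  move=> c0 ch; rewrite /rl_integral /Rintegral fineK//.
  apply: (@integrable_fin_num _ _ R mu _ (measurable_itv _)).
  exact: (integrable_kernelM hrho x c0 (lexx 0) ch).
rewrite (EJ a _ t a0 cJ) (EJ _ _ t ab0 cg).
pose f (p : R * R) : R := if (0 < p.2) && (p.2 < p.1) && (p.1 < t) then
  kpow a t p.1 * wpow p.1 * (kpow b p.1 p.2 * wpow p.2 * g p.2) else 0.
have mf : measurable_fun setT (EFin \o f).
  apply/measurable_EFinP; apply: measurable_fun_ifT => //.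
    apply: measurable_and; last exact: measurable_fun_ltr.
    by apply: measurable_and; exact: measurable_fun_ltr.
  apply: measurable_funM.
    apply: measurable_funM; first exact: measurableT_comp (measurable_kpow _ _ _) _.
    exact: measurableT_comp (measurable_wpow _) _.
  rewrite (_ : (fun p => _) = (fun p : R * R => kpow b p.1 p.2 * (wpow p.2 * g p.2))); last first.
    by apply/funext => p; rewrite mulrA.
  apply: measurable_funM.
    apply: (measurableT_comp (measurable_powR _)); apply: measurable_funB.
      exact: measurableT_comp (measurable_powR _) _.
    exact: measurableT_comp (measurable_powR _) _.
  exact: (measurableT_comp (measurable_wpow_g cg)).
have f0 p : (0 <= (EFin \o f) p)%E.
  rewrite lee_fin /f; case: ifPn => // /andP[/andP[p0 pp] pt].
  apply: mulr_ge0; first exact: kernel_ge0.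
  apply: mulr_ge0; first exact: kernel_ge0.
  by apply: g0; rewrite p0 (lt_trans pp).
have := @fubini_tonelli _ _ _ _ R mu mu (EFin \o f) mf f0.
have -> : (\int[mu]_x \int[mu]_y (EFin \o f) (x, y) =
    \int[mu]_(s in `]0%R, t[) (kpow a t s * wpow s * RLint b g s)%:E)%E.
  rewrite [RHS]integral_mkcond; apply: eq_integral => s _.
  rewrite patchE; case: ifPn => [|st].
    rewrite inE/= in_itv/= => /andP[s0 st].
    rewrite EFinM (EJ b g s b0 cg).
    rewrite -ge0_integralZl_EFin//; last 3 first.
    - move=> r/=; rewrite in_itv/= lee_fin => /andP[r0 rs].
      apply: mulr_ge0; first exact: kernel_ge0.
      by apply: g0; rewrite r0 (lt_trans rs).
    - apply/measurable_EFinP/measurable_funTS/measurable_funM.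
        apply: measurable_funM; first exact: measurable_kpow.
        exact: measurable_wpow.
      exact: continuous_measurable_fun.
    - exact: kernel_ge0.
    rewrite [RHS]integral_mkcond; apply: eq_integral => r _ /=.
    rewrite patchE /f/= st andbT; case: ifPn => [r0s|]; last first.
      by move=> nr; rewrite ifF//; apply/negP; rewrite inE/= in_itv/=; apply/negP.
    by rewrite ifT ?inE/= ?in_itv//= -EFinM.
  apply: integral0_eq => r _ /=; rewrite /f/= ifF//; apply/negP => /andP[/andP[r0 rs] st'].
  by move/negP : st; apply; rewrite inE/= in_itv/= st' (lt_trans r0).
have -> : (\int[mu]_y \int[mu]_x (EFin \o f) (x, y) =
   (Beta a b)%:E * \int[mu]_(s in `]0%R, t[) (kpow (a + b) t s * wpow s * g s)%:E)%E.
  rewrite -ge0_integralZl_EFin//; last 3 first.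
  - move=> r/=; rewrite in_itv/= lee_fin => r0t.
    by apply: mulr_ge0; [exact: kernel_ge0|exact: g0].
  - apply/measurable_EFinP/measurable_funTS/measurable_funM.
      apply: measurable_funM; first exact: measurable_kpow.
      exact: measurable_wpow.
    exact: continuous_measurable_fun.
  - by rewrite ltW// Beta_gt0.
  rewrite [RHS]integral_mkcond; apply: eq_integral => r _ /=.
  rewrite patchE; case: ifPn => [|rt].
    rewrite inE/= in_itv/= => /andP[r0 rt].
    have -> : ((Beta a b)%:E * (kpow (a + b) t r * wpow r * g r)%:E =
      (wpow r * g r)%:E * (Beta a b * (t `^ rho - r `^ rho) `^ (a + b - 1))%:E)%E.
      by rewrite -!EFinM; congr EFin; rewrite /clock_kernel; ring.
    rewrite -(kernel_conv hrho a0 b0 (ltW r0) rt).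
    rewrite -ge0_integralZl_EFin//; last 3 first.
    - move=> s _; rewrite lee_fin mulrAC; apply: mulr_ge0; first exact: kernel_ge0.
      exact: kpow_ge0.
    - apply/measurable_EFinP/measurable_funTS/measurable_funM; last exact: measurable_wpow.
      apply: measurable_funM; first exact: measurable_kpow.
      apply: (measurableT_comp (measurable_powR _)).
      by apply: measurable_funB => //; exact: measurable_powR.
    - by rewrite mulr_ge0 ?wpow_ge0 ?g0// r0.
    rewrite [RHS]integral_mkcond; apply: eq_integral => s _ /=.
    rewrite patchE /f/= r0/=; case: ifPn => [rst|]; last first.
      by move=> nr; rewrite ifF//; apply/negP; rewrite inE/= in_itv/=; apply/negP.
    rewrite ifT ?inE/= ?in_itv//= -EFinM; congr EFin.
    by move: (clock_kernel _ _ _ _) (clock_weight _ s) (clock_kernel _ _ _ _) (clock_weight _ r) (g r) => A B C D E; ring.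
  apply: integral0_eq => s _ /=; rewrite /f/= ifF//; apply/negP => /andP[/andP[r0 rs] st'].
  by move/negP : rt; apply; rewrite inE/= in_itv/= r0 (lt_trans rs).
exact.
Qed.

(** Adding a constant M makes g nonnegative on the interval, and the constant
    function M is itself covered by the nonnegative case. *)
Lemma RLint_semigroup a b g t : 0 < a -> 0 < b -> continuous g ->
  RLint a (RLint b g) t = Beta a b * RLint (a + b) g t.
Proof.
move=> a0 b0 cg; have ab0 := addr_gt0 a0 b0.
have [M M0 gM] := continuous_bounded_itv t cg.
have c1 : continuous (fun _ : R => 1 : R) by move=> x; exact: cvg_cst.
pose one := fun _ : R => 1 : R.
pose gM' s := M * one s + g s.
have cg' : continuous gM'.
  by move=> x; apply: cvgD; [apply: cvgM; exact: cvg_cst|exact: cg].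
have := @RLint_semigroup_ge0 a b gM' t a0 b0 cg'.
have J1 : RLint b gM' = fun s => M * RLint b one s + RLint b g s.
  by apply/funext => s; rewrite (RLint_linear hrho M s b0 c1 cg).
rewrite J1 (RLint_linear hrho M t a0 (continuous_RLint b0 c1) (continuous_RLint b0 cg)).
rewrite (RLint_linear hrho M t ab0 c1 cg).
rewrite (@RLint_semigroup_ge0 a b one t a0 b0 c1)//.
move=> H; have {H} := H.
have gp s : 0 < s < t -> 0 <= gM' s.
  move=> /andP[s0 st]; rewrite /gM' mulr1 -lerBlDl sub0r.
  by have := gM s; rewrite (ltW s0) (ltW st) => /(_ isT); rewrite ler_norml => /andP[].
move=> /(_ gp).
move: (RLint a _ t) (RLint (a + b) _ t) (RLint (a + b) g t) => x y z.
by rewrite mulrDr mulrCA => /addrI.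
Qed.

Lemma RLint_addl a b g t : 0 < a -> 0 < b -> continuous g ->
  RLint (a + b) g t = (Beta a b)^-1 * RLint a (RLint b g) t.
Proof.
move=> a0 b0 cg; rewrite RLint_semigroup// mulrA mulVf ?mul1r// gt_eqF// Beta_gt0//.
Qed.

End FractionalIntegralCalculus.

(** * Derivatives within ]0, d] *)
Section DerivativeIn.
Context {R : realType}.
Implicit Types (d t s l c x y : R) (g : R -> R).

(** A relational form of the derivative within ]0, d]: it asserts existence
    together with the value, so that no limit operator has to be handled. *)
Definition has_derive_in d g t l : Prop :=
  diff_quot g t s @[s --> within `]0, d] t^'] --> l.

#[local] Instance nbhs_within_filter d t : Filter (within `]0, d] t^').
Proof. exact: within_filter. Qed.

Lemma nbhs_within_proper d t : 0 < t -> t <= d ->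
  ProperFilter (within `]0, d] t^').
Proof.
move=> t0 td; apply: Build_ProperFilter_ex => P [e /= e0 eP].
pose s := t - Num.min e t / 2.
have m0 : 0 < Num.min e t by rewrite lt_min e0 t0.
have m1 : Num.min e t <= e by rewrite ge_min lexx.
have m2 : Num.min e t <= t by rewrite ge_min lexx orbT.
exists s; apply: eP.
- by rewrite /= /s opprD addrA subrr sub0r opprK ger0_norm; lra.
- have st : s < t by rewrite /s; lra.
  by rewrite /= (lt_eqF st).
- by rewrite /= in_itv/= /s; lra.
Qed.

Lemma has_derive_in_unique d g t l l' : 0 < t -> t <= d ->
  has_derive_in d g t l -> has_derive_in d g t l' -> l = l'.
Proof.
move=> t0 td h1 h2; have := nbhs_within_proper t0 td => ?.
exact: (cvg_unique _ h1 h2).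
Qed.

Lemma derive_in_val d g t l : 0 < t -> t <= d -> has_derive_in d g t l ->
  derive_in `]0, d] g t = l.
Proof.
move=> t0 td h1; have := nbhs_within_proper t0 td => ?.
exact: cvg_lim.
Qed.

Lemma has_derive_in_exists d g t l : has_derive_in d g t l -> derivable_in `]0, d] g t.
Proof. by move=> h; apply/cvg_ex; exists l. Qed.

Lemma derivable_inP d g t : derivable_in `]0, d] g t ->
  has_derive_in d g t (derive_in `]0, d] g t).
Proof. by []. Qed.

Lemma has_derive_in_le d d' g t l : d' <= d -> has_derive_in d g t l ->
  has_derive_in d' g t l.
Proof.
move=> dd; apply: cvg_trans; apply: cvg_app => P; rewrite /within /= /nbhs/=.
apply: filterS => s hs; rewrite in_itv/= => /andP[s0 sd]; apply: hs.
by rewrite in_itv/= s0 (le_trans sd).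
Qed.

Lemma has_derive_in_epsP d g t l : has_derive_in d g t l <->
  forall e, 0 < e -> exists2 de, 0 < de &
    forall s, 0 < s -> s <= d -> s != t -> `|t - s| < de -> `|l - diff_quot g t s| < e.
Proof.
split=> [/cvgrPdist_lt h e e0|h].
  have [de /= de0 hde] := h e e0; exists de => // s s0 sd st ts.
  by apply: (hde s) => //=; rewrite in_itv/= s0.
apply/cvgrPdist_lt => e e0; have [de de0 hde] := h e e0.
exists de => //= s /= ts st; rewrite in_itv/= => /andP[s0 sd].
exact: hde.
Qed.

Lemma is_derive_has_derive_in d g t l : is_derive t 1 g l -> has_derive_in d g t l.
Proof.
move=> [dg gl]; apply/has_derive_in_epsP => e e0.
have : h^-1 *: (g (h *: 1 + t) - g t) @[h --> 0^'] --> l by rewrite -gl.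
move=> /cvgrPdist_lt/(_ e e0)[de /= de0 hde]; exists de => // s _ _ st ts.
have := hde (s - t); rewrite /= sub0r opprB => /(_ ts); rewrite subr_eq0 => /(_ st).
by rewrite /diff_quot /GRing.scale/= mulr1 subrK mulrC.
Qed.

Lemma has_derive_in_is_derive d g t l : 0 < t -> t < d ->
  has_derive_in d g t l -> is_derive t 1 g l.
Proof.
move=> t0 td /has_derive_in_epsP h.
have c : h^-1 *: (g (h *: 1 + t) - g t) @[h --> 0^'] --> l.
  apply/cvgrPdist_lt => e e0; have [de de0 hde] := h e e0.
  pose m := Num.min de (Num.min t (d - t)).
  have m0 : 0 < m by rewrite !lt_min de0 t0 subr_gt0.
  exists m => //= k /=; rewrite sub0r normrN => km k0.
  have mde : m <= de by rewrite ge_min lexx.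
  have mt : m <= t by rewrite !ge_min lexx orbT.
  have md : m <= d - t by rewrite !ge_min lexx !orbT.
  have := hde (k + t).
  rewrite /diff_quot addrK opprD addrCA subrr addr0 normrN /GRing.scale/= mulr1 [X in `|l - X|]mulrC.
  move: km; rewrite ltr_norml => km.
  apply; [lra|lra| |by rewrite ltr_norml; lra].
  by rewrite -subr_eq0 addrK.
by split; [apply/cvg_ex; exists l|exact/cvg_lim].
Qed.

Lemma eq_has_derive_in d g1 g2 t l : 0 < t -> t <= d ->
  (forall s, 0 < s -> s <= d -> g1 s = g2 s) ->
  has_derive_in d g1 t l -> has_derive_in d g2 t l.
Proof.
move=> t0 td g12 /has_derive_in_epsP h; apply/has_derive_in_epsP => e /h[de de0 hde].
exists de => // s s0 sd st ts.
by rewrite /diff_quot -!g12//; exact: hde.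
Qed.

Lemma eq_cvg_punctured d t (p q : R -> R) (l l' : R) :
  (forall s, s != t -> p s = q s) -> l = l' ->
  p s @[s --> within `]0, d] t^'] --> l -> q s @[s --> within `]0, d] t^'] --> l'.
Proof.
move=> pq <- /cvgrPdist_lt h; apply/cvgrPdist_lt => e /h[de /= de0 hde].
by exists de => //= s ts st sd; rewrite -pq//; exact: hde.
Qed.

Lemma has_derive_in_continuous d g t l : has_derive_in d g t l ->
  g s @[s --> within `]0, d] t^'] --> g t.
Proof.
move=> h; have ct : (s - t) @[s --> within `]0, d] t^'] --> (0 : R).
  apply/cvgrPdist_lt => e e0; exists e => //= s ts _ _.
  by rewrite sub0r normrN distrC.
have FF := nbhs_within_filter d t.
apply: (eq_cvg_punctured _ _ (cvgD (cvgM h ct) (cvg_cst (g t)))).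
  by move=> s st; rewrite /diff_quot/= [LHS]/= mulfVK ?subrK// subr_eq0.
by rewrite mulr0 add0r.
Qed.

Lemma has_derive_in_continuous_eps d g t l : has_derive_in d g t l ->
  forall e, 0 < e -> exists2 de, 0 < de &
    forall s, 0 < s -> s <= d -> `|t - s| < de -> `|g t - g s| < e.
Proof.
move=> /has_derive_in_continuous/cvgrPdist_lt hc e e0.
have [de /= de0 hde] := hc e e0; exists de => // s s0 sd ts.
have [->|st] := eqVneq s t; first by rewrite subrr normr0.
by apply: hde => //; rewrite /= in_itv/= s0.
Qed.

Lemma has_derive_inM d g1 g2 t l1 l2 :
  has_derive_in d g1 t l1 -> has_derive_in d g2 t l2 ->
  has_derive_in d (fun s => g1 s * g2 s) t (l1 * g2 t + g1 t * l2).
Proof.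
move=> h1 h2; have c2 := has_derive_in_continuous h2.
have FF := nbhs_within_filter d t.
apply: (eq_cvg_punctured _ _ (cvgD (cvgM h1 c2) (cvgM (cvg_cst (g1 t)) h2))) => //.
move=> s st; rewrite /diff_quot [LHS]/=.
by rewrite mulrAC mulrA -mulrDl; congr (_ / _); ring.
Qed.

Lemma has_derive_inD d g1 g2 t l1 l2 :
  has_derive_in d g1 t l1 -> has_derive_in d g2 t l2 ->
  has_derive_in d (fun s => g1 s + g2 s) t (l1 + l2).
Proof.
move=> h1 h2; have FF := nbhs_within_filter d t.
apply: (eq_cvg_punctured _ _ (cvgD h1 h2)) => // s st.
by rewrite /diff_quot [LHS]/= -mulrDl; congr (_ / _); ring.
Qed.

Lemma has_derive_inZ d c g t l :
  has_derive_in d g t l -> has_derive_in d (fun s => c * g s) t (c * l).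
Proof.
move=> h; have FF := nbhs_within_filter d t.
apply: (eq_cvg_punctured _ _ (cvgM (cvg_cst c) h)) => // s st.
by rewrite /diff_quot [LHS]/= mulrA mulrBr.
Qed.

(** At the right end point d the one-sided derivative gives continuity, which
    is all that the mean value theorem asks for there. *)
Lemma has_derive_in_MVT d g (l : R -> R) x y : 0 < x -> x < y -> y <= d ->
  (forall t, 0 < t -> t <= d -> has_derive_in d g t (l t)) ->
  exists2 c, 0 < c <= d & g y - g x = l c * (y - x).
Proof.
move=> x0 xy yd h.
have [||c] := @MVT R g l x y xy.
- move=> t; rewrite in_itv/= => /andP[xt ty].
  apply: (@has_derive_in_is_derive d); first exact: lt_trans xt.
    exact: lt_le_trans yd.
  by apply: h; [exact: lt_trans xt|exact: le_trans (ltW ty) yd].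
- apply/subspace_continuousP => t /=; rewrite in_itv/= => /andP[xt ty].
  have t0 : 0 < t by exact: lt_le_trans xt.
  have hc := has_derive_in_continuous_eps (h t t0 (le_trans ty yd)).
  move=> U /nbhs_ballP[e /= /hc[de de0 hde] eU]; exists de => //= s ts.
  by rewrite in_itv/= => /andP[xs sy]; apply: eU; apply: hde; rewrite ?(lt_le_trans x0 xs) ?(le_trans sy).
move=> cxy e; exists c => //; move: cxy; rewrite in_itv/= => /andP[xc cy].
by rewrite (lt_trans x0)// (le_trans (ltW cy)).
Qed.

Lemma has_derive_in0_cst d g :
  (forall t, 0 < t -> t <= d -> has_derive_in d g t 0) ->
  forall x y, 0 < x -> x <= d -> 0 < y -> y <= d -> g x = g y.
Proof.
move=> h x y x0 xd y0 yd.
wlog : x y x0 xd y0 yd / x < y.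
  by move=> W; have [/W->//|/W->//|->//] := ltgtP x y.
move=> xy; have [c _ /eqP] := has_derive_in_MVT x0 xy yd h.
by rewrite mul0r subr_eq0 => /eqP.
Qed.

End DerivativeIn.

(** * Iterated derivatives in the clock *)
Section Chains.
Context {R : realType}.
Variable rho : R.
Hypothesis hrho : 0 < rho.
Implicit Types (d t s l c x y e M : R) (g p : R -> R) (n j k : nat) (P Q : {poly R}).
Notation wpow := (clock_weight rho).
Notation I1 := (rl_integral rho 1).

(** G j is the j-th derivative of G 0 with respect to t^rho, for j <= n; the
    chain rule puts the factor rho t^(rho-1) in front of d/dt. *)
Definition delta_chain d n (G : nat -> R -> R) : Prop :=
  forall j, (j < n)%N -> forall t, 0 < t -> t <= d ->
    has_derive_in d (G j) t (wpow t * G j.+1 t).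

Lemma is_derive_poly_pow P t : 0 < t ->
  is_derive t 1 (fun t => P.[t `^ rho]) (wpow t * (P^`()).[t `^ rho]).
Proof.
move=> t0; have dp := is_derive1_powR rho t0.
have := @is_derive1_comp _ (fun u => P.[u]) (@powR R ^~ rho) t _ _ (is_derive_poly P _) dp.
by move=> /trigger_derive; apply; rewrite mulrC.
Qed.

(** M t^rho - g and M t^rho + g have nonnegative derivatives and tend to 0. *)
Lemma delta_bound_near0 d g p M :
  (forall t, 0 < t -> t <= d -> has_derive_in d g t (wpow t * p t)) ->
  (forall t, 0 < t -> t <= d -> `|p t| <= M) ->
  g t @[t --> 0^'+] --> 0 ->
  forall t, 0 < t -> t <= d -> `|g t| <= M * t `^ rho.
Proof.
move=> dg pM g0 t t0 td.
(* c = 1 and c = -1 give the two sides of the bound *)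
have half (c : R) : `|c| = 1 -> c * g t <= M * t `^ rho.
  move=> c1; pose k s := M * s `^ rho + (- c) * g s.
  have dk s : 0 < s -> s <= d -> has_derive_in d k s (M * wpow s + (- c) * (wpow s * p s)).
    move=> s0 sd; apply: has_derive_inD; last by apply: has_derive_inZ; exact: dg.
    apply: has_derive_inZ; apply: is_derive_has_derive_in; exact: is_derive1_powR.
  have kle s : 0 < s -> s < t -> k s <= k t.
    move=> s0 st; have [x /andP[x0 xd] e] := has_derive_in_MVT s0 st td dk.
    rewrite -subr_ge0 e mulr_ge0 ?subr_ge0 ?(ltW st)//.
    rewrite (_ : _ + _ = wpow x * (M - c * p x)); last by ring.
    rewrite mulr_ge0 ?wpow_ge0// subr_ge0 (le_trans (ler_norm _))// normrM c1 mul1r.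
    exact: pM.
  have k0 : k s @[s --> 0^'+] --> 0.
    rewrite -[X in _ --> X](_ : M * 0 + (- c) * 0 = 0); last by rewrite !mulr0 addr0.
    apply: cvgD; apply: cvgM => //; try exact: cvg_cst.
    exact: powR_cvg0.
  have : 0 <= k t.
    apply: (cvgr_to_le k0); near=> s; apply: kle; first by near: s; exact: nbhs_right_gt.
    by near: s; exact: nbhs_right_lt.
  by rewrite /k mulNr subr_ge0.
rewrite ler_norml; apply/andP; split.
  by have := half (-1); rewrite normrN normr1 mulN1r lerNl; exact.
by have := half 1; rewrite normr1 mul1r; exact.
Unshelve. all: end_near. Qed.

(** Taylor's estimate at 0 without integrating G n, which need not be
    measurable: the mean value inequality is applied n times. *)
Lemma delta_chain_bound d n (G : nat -> R -> R) M :
  delta_chain d n G -> (forall t, 0 < t -> t <= d -> `|G n t| <= M) ->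
  (forall j, (j < n)%N -> G j t @[t --> 0^'+] --> 0) ->
  forall t, 0 < t -> t <= d -> `|G 0%N t| <= M * (t `^ rho) ^+ n.
Proof.
elim: n G => [|n IH] G cG GM G0 t t0 td; first by rewrite expr0 mulr1 GM.
have M0 : 0 <= M by rewrite (le_trans (normr_ge0 _) (GM t t0 td)).
have h1 s : 0 < s -> s <= d -> `|G 1%N s| <= M * (s `^ rho) ^+ n.
  move=> s0 sd; apply: (IH (fun j => G j.+1)) => //.
    by move=> j jn; exact: cG.
  by move=> j jn; exact: G0.
rewrite exprSr mulrA; apply: (@delta_bound_near0 t (G 0%N) (G 1%N)) => //.
- move=> s s0 st; apply: (has_derive_in_le td); apply: cG => //.
  exact: le_trans td.
- move=> s s0 st; rewrite (le_trans (h1 _ s0 (le_trans st td)))//.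
  by rewrite ler_wpM2l// lerXn2r ?nnegrE ?powR_ge0// ler_powRl// ltW.
- exact: G0.
Qed.

Definition primitive n Q : {poly R} := \poly_(i < n.+1) (Q`_i.-1 / i%:R).

(** The coefficient of index 0 of the primitive is Q`_0 / 0 = 0. *)
Lemma deriv_primitive n Q : (size Q <= n)%N -> (primitive n Q)^`() = Q.
Proof.
move=> sQ; apply/polyP => i; rewrite coef_deriv coef_poly ltnS /=.
case: ltnP => iN; first by rewrite -(mulr_natr (_ / _)) divfK// pnatr_eq0.
by rewrite mul0rn nth_default// (leq_trans sQ).
Qed.

Lemma continuous_iter_I1 n g : continuous g -> continuous (iter n I1 g).
Proof. by move=> cg; elim: n => [//|n IH]; apply: continuous_RLint. Qed.

(** Integrate one step at a time: a function whose derivative is that of an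
    explicit one differs from it by a constant, and the constants build up a
    polynomial in the clock. *)
Lemma delta_chain_integrate d n (G : nat -> R -> R) g : 0 < d ->
  delta_chain d n G -> continuous g ->
  (forall t, 0 < t -> t <= d -> G n t = g t) ->
  exists2 P : {poly R}, (size P <= n)%N &
    forall t, 0 < t -> t <= d -> G 0%N t = iter n I1 g t + P.[t `^ rho].
Proof.
move=> d0; elim: n G => [|n IH] G cG cg Gn.
  by exists 0; rewrite ?size_poly0// => t t0 td; rewrite horner0 addr0 Gn.
have [Q sQ G1] := IH (fun j => G j.+1) (fun j jn => cG j.+1 jn) cg Gn.
pose H t := G 0%N t + (-1) * (iter n.+1 I1 g t + (primitive n Q).[t `^ rho]).
have dH t : 0 < t -> t <= d -> has_derive_in d H t 0.
  move=> t0 td.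
  rewrite -[0](_ : wpow t * G 1%N t + (-1) * (wpow t * iter n I1 g t + wpow t * Q.[t `^ rho]) = 0); last first.
    by rewrite G1// -mulrDr mulN1r subrr.
  apply: has_derive_inD; first exact: cG.
  apply: has_derive_inZ; apply: has_derive_inD; apply: is_derive_has_derive_in.
    by apply: is_derive_RLint1 => //; exact: continuous_iter_I1.
  by rewrite -[X in _ * X.[_]](deriv_primitive sQ); exact: is_derive_poly_pow.
exists (primitive n Q + (H d)%:P).
  rewrite (leq_trans (size_polyD _ _))// geq_max size_poly/=.
  by rewrite (leq_trans (size_polyC_leq1 _)).
move=> t t0 td; rewrite hornerD hornerC addrA.
rewrite -(has_derive_in0_cst dH t0 td d0 (lexx d)) /H mulN1r.
by move: (iter _ _ _ _) => z; ring.
Qed.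

(** Otherwise factor P as 'X^k * Q with Q.[0] != 0 and k <= n; dividing the
    bound by u^k makes |Q.[u]| arbitrarily small near 0. *)
Lemma poly_small_eq0 P n : (size P <= n.+1)%N ->
  (forall e, 0 < e -> exists2 d, 0 < d & forall u, 0 < u -> u <= d -> `|P.[u]| <= e * u ^+ n) ->
  P = 0.
Proof.
move=> sP small; apply/eqP/negPn/negP => P0.
have [k [Q]] := multiplicity_XsubC P 0; rewrite P0 /= subr0 => Q0 PE.
have Q00 : Q.[0] != 0 by exact: Q0.
have kn : (k <= n)%N.
  have Qn0 : Q != 0 by apply: contraNneq Q00 => ->; rewrite horner0.
  move: sP; rewrite PE size_mulXn// => h; rewrite -ltnS (leq_trans _ h)// -addn1.
  by rewrite leq_add2l size_poly_gt0.
pose e := `|Q.[0]| / 4.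
have e0 : 0 < e by rewrite divr_gt0// normr_gt0.
have [d d0 hd] := small _ e0.
have cQ := @continuous_horner _ Q 0.
move/cvgrPdist_lt : cQ => /(_ e e0)[de /= de0 hde].
pose u := Num.min 1 (Num.min d de) / 2.
have m0 : 0 < Num.min 1 (Num.min d de) by rewrite !lt_min ltr01 d0 de0.
have m1 : Num.min 1 (Num.min d de) <= 1 by rewrite ge_min lexx.
have m2 : Num.min 1 (Num.min d de) <= d by rewrite !ge_min lexx !orbT.
have m3 : Num.min 1 (Num.min d de) <= de by rewrite !ge_min lexx !orbT.
have u0 : 0 < u by rewrite /u; lra.
have u1 : u <= 1 by rewrite /u; lra.
have ud : u <= d by rewrite /u; lra.
have ude : u < de by rewrite /u; lra.
have h1 := hde u; rewrite /= sub0r normrN gtr0_norm// in h1.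
have {}h1 := h1 ude.
have h2 : `|Q.[u]| <= e.
  have := hd u u0 ud; rewrite PE hornerM hornerXn normrM (gtr0_norm (exprn_gt0 _ u0)).
  rewrite -(subnK kn) exprD mulrA ler_pM2r ?exprn_gt0// => h.
  apply: (le_trans h); rewrite ler_piMr ?(ltW e0)// exprn_ile1// ltW//.
have : `|Q.[0]| < e + e.
  rewrite -[X in `|X|](subrK Q.[u]) (le_lt_trans (ler_normD _ _))//.
  exact: ltr_leD.
by rewrite /e in e0 *; move: e0; move: `|Q.[0]| => z; lra.
Qed.

End Chains.

(** * Substantial derivatives as derivatives in the clock *)
Section SubstantialChains.
Context {R : realType}.
Variables sigma rho h : R.
Hypothesis hrho : 0 < rho.
Hypothesis h0 : 0 < h.
Implicit Types (d t s l : R) (g psi : R -> R) (n j k : nat).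
Notation wpow := (clock_weight rho).

(** Multiplication by this function conjugates Dsub1 to the derivative in the
    clock. *)
Definition exp_clock t : R := expR (sigma * t `^ rho).

Notation twist := exp_clock.

Lemma twist_gt0 t : 0 < twist t. Proof. exact: expR_gt0. Qed.

Lemma twist_neq0 t : twist t != 0. Proof. by rewrite gt_eqF ?twist_gt0. Qed.

Lemma wpow_inv t : 0 < t -> wpow t * (t `^ (1 - rho) / rho) = 1.
Proof.
move=> t0; have tn0 : t != 0 by rewrite gt_eqF.
have e : t `^ (rho - 1) * t `^ (1 - rho) = 1.
  by rewrite -powRD ?tn0 ?implybT// addrC subrKA subrr powRr0.
rewrite /clock_weight; move: e; move: (t `^ (rho - 1)) (t `^ (1 - rho)) => x y xy.
by rewrite mulrA -(mulrA rho) xy mulr1 divff// gt_eqF.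
Qed.

Lemma has_derive_in_exp_pow c d t : 0 < t ->
  has_derive_in d (fun t => expR (c * t `^ rho)) t (wpow t * (c * expR (c * t `^ rho))).
Proof.
move=> t0; apply: is_derive_has_derive_in.
have dp := is_deriveM (is_derive_cst c t 1) (is_derive1_powR rho t0).
have := @is_derive1_comp _ expR (fun t => c * t `^ rho) t _ _ (is_derive_expR _) dp.
move=> /trigger_derive; apply; rewrite scaler0 addr0 /GRing.scale/= /clock_weight.
by move: (expR _) (_ `^ (rho - 1)) => x y; rewrite /cst; ring.
Qed.

(** The conjugation: the factor of wpow t is exp_clock times Dsub1 g. *)
Lemma has_derive_in_twistM d g t l : 0 < t -> has_derive_in d g t l ->
  has_derive_in d (fun s => twist s * g s) t
    (wpow t * (twist t * (t `^ (1 - rho) / rho * l + sigma * g t))).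
Proof.
move=> t0 dg; have := has_derive_inM (@has_derive_in_exp_pow sigma d t t0) dg.
rewrite -/(twist t); congr has_derive_in; have := wpow_inv t0.
move: (wpow t) (t `^ (1 - rho) / rho) (twist t) (g t) => w v T y wv.
by transitivity (w * v * T * l + w * (sigma * T) * y); [rewrite wv mul1r addrC|ring].
Qed.

Lemma has_derive_in_untwist d g t q : 0 < t -> has_derive_in d g t (wpow t * q) ->
  has_derive_in d (fun s => (twist s)^-1 * g s) t
    (wpow t * ((twist t)^-1 * q - sigma * ((twist t)^-1 * g t))).
Proof.
move=> t0 dg; have := has_derive_inM (@has_derive_in_exp_pow (- sigma) d t t0) dg.
have -> : (fun s => expR (- sigma * s `^ rho) * g s) = (fun s => (twist s)^-1 * g s).
  by apply/funext => s; rewrite mulNr expRN.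
rewrite [- sigma * t `^ rho]mulNr expRN -/(twist t); congr has_derive_in.
by move: (wpow t) (twist t)^-1 (g t) => w T y; ring.
Qed.

(** The derivatives within ]0, h] are restricted to ]0, d] because the initial
    conditions only provide them near 0. *)
Lemma Dsub_delta_chain d n g : d <= h ->
  (forall t, 0 < t -> t <= d -> Dsub_exists sigma rho h n g t) ->
  delta_chain rho d n (fun j t => twist t * Dsub sigma rho h j g t).
Proof.
move=> dh ex j jn t t0 td; have /derivable_inP := ex t t0 td j jn.
by move=> /(has_derive_in_le dh) /(has_derive_in_twistM t0).
Qed.

Lemma delta_chain_Dsub n g (G : nat -> R -> R) :
  (forall t, 0 < t -> t <= h -> twist t * g t = G 0%N t) ->
  delta_chain rho h n G ->
  forall j, (j <= n)%N -> forall t, 0 < t -> t <= h ->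
    Dsub sigma rho h j g t = (twist t)^-1 * G j t /\ Dsub_exists sigma rho h j g t.
Proof.
move=> g0 cG; elim=> [|j IH] jn t t0 th.
  by split => //; rewrite -g0// mulrA mulVf ?mul1r// twist_neq0.
have D s : 0 < s -> s <= h ->
    has_derive_in h (Dsub sigma rho h j g) s
      (wpow s * ((twist s)^-1 * G j.+1 s - sigma * ((twist s)^-1 * G j s))).
  move=> s0 sh; apply: (@eq_has_derive_in _ _ (fun s => (twist s)^-1 * G j s)) => //.
    by move=> x x0 xh; have [] := IH (ltnW jn) x x0 xh.
  by apply: has_derive_in_untwist => //; exact: cG.
have [Dj exj] := IH (ltnW jn) t t0 th.
split; last first.
  move=> i; rewrite ltnS leq_eqVlt => /predU1P[->|]; last exact: exj.
  exact: has_derive_in_exists (D t t0 th).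
rewrite /Dsub iterS -/(Dsub sigma rho h j g) /Dsub1 (derive_in_val t0 th (D t t0 th)) Dj.
have := wpow_inv t0; move: (wpow t) (t `^ (1 - rho) / rho) => w v wv.
by rewrite mulrA [v * w]mulrC wv mul1r subrK.
Qed.

Lemma twist_cvg0 : twist t @[t --> 0^'+] --> (1 : R).
Proof.
have c : sigma * t `^ rho @[t --> 0^'+] --> (0 : R).
  have := cvgM (cvg_cst sigma) (@powR_cvg0 R rho hrho); rewrite mulr0; exact.
by have := cvg_comp _ _ c (@continuous_expR R 0); rewrite expR0.
Qed.

Lemma near0_itv (P : R -> Prop) : (forall t, 0 < t -> t <= h -> P t) ->
  \forall t \near 0^'+, P t.
Proof.
move=> hP; near=> t; apply: hP; first by near: t; exact: nbhs_right_gt.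
by near: t; exact: nbhs_right_le.
Unshelve. all: end_near. Qed.

Lemma Dsub_at0_delta_chain k n g (G : nat -> R -> R) l :
  (forall t, 0 < t -> t <= h -> twist t * g t = G 0%N t) ->
  delta_chain rho h n G -> (k <= n)%N -> G k t @[t --> 0^'+] --> l ->
  Dsub_at0_exists sigma rho h k g /\ Dsub_at0 sigma rho h k g = l.
Proof.
move=> g0 cG kn Gl.
have D : Dsub sigma rho h k g t @[t --> 0^'+] --> l.
  have c : ((twist t)^-1 * G k t) @[t --> 0^'+] --> (1^-1 * l : R).
    by apply: cvgM => //; apply: cvgV; [exact: oner_neq0|exact: twist_cvg0].
  rewrite invr1 mul1r in c; apply: (cvg_trans _ c).
  apply: near_eq_cvg; apply: near0_itv => t t0 th /=.
  by have [-> _] := delta_chain_Dsub g0 cG kn t0 th.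
split; last exact: cvg_lim.
split; last by apply/cvg_ex; exists l.
by apply: near0_itv => t t0 th; have [_] := delta_chain_Dsub g0 cG kn t0 th.
Qed.

End SubstantialChains.

(** * The Gamma integral *)
Section GammaFacts.
Context {R : realType}.
Implicit Types (x : R).
Notation mu := (@lebesgue_measure R).

Lemma measurable_expRN : measurable_fun setT (fun s : R => expR (- s)).
Proof.
apply: continuous_measurable_fun => s.
by apply: (@continuous_comp _ _ _ -%R expR); [exact: opp_continuous|exact: continuous_expR].
Qed.

Lemma integrable_expRN : mu.-integrable `]0, +oo[ (EFin \o (fun s : R => expR (- s))).
Proof.
have i1 : mu.-integrable `]0, +oo[ (EFin \o exponential_pdf (1 : R)).
  by apply: integrableS (integrable_exponential_pdf ltr01).
apply: eq_integrable i1 => // s; rewrite inE/= in_itv/= andbT => s0.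
by rewrite exponential_pdfE ?ltW// mul1r mulN1r.
Qed.

(** The Gamma integrand at 1 is the exponential density of rate 1. *)
Lemma Gamma1 : Gamma (1 : R) = 1.
Proof.
have e : (\int[mu]_(s in `]0%R, +oo[) (expR (- s))%:E = 1)%E.
  rewrite integral_itv_obnd_cbnd; last first.
    by apply/measurable_EFinP/measurable_funTS; exact: measurable_expRN.
  rewrite integral_mkcond -[RHS](integral_exponential_pdf (@ltr01 R)).
  apply: eq_integral => s _; rewrite patchE /exponential_pdf patchE.
  by case: ifP => // _; rewrite mul1r mulN1r.
rewrite /Gamma /Rintegral -[RHS]/(fine 1%E) -e; congr fine.
by apply: eq_integral => s _; rewrite subrr powRr0 mul1r.
Qed.

(** For x <= 1 the integrand is at most s^(x-1) on ]0, 1[ and at most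
    exp (- s) beyond. Integrability matters even for positivity, since the
    real-valued integral of a function of infinite mass is 0. *)
Lemma Gamma_gt0 x : 0 < x -> x <= 1 -> 0 < Gamma x.
Proof.
move=> x0 x1.
pose g1 : R -> R := (fun s : R => s `^ (x - 1)) \_ `]0, 1[.
have mp : measurable_fun setT (fun s : R => s `^ (x - 1)) by exact: measurable_powR.
have i1 : mu.-integrable `]0, +oo[ (EFin \o g1).
  rewrite /g1 -restrict_EFin; apply/integrable_restrict => //=.
  rewrite (_ : _ `&` _ = `]0, 1[%classic); last first.
    by rewrite setIidr//; apply: subset_itvl; rewrite bnd_simp.
  apply/integrableP; split; first by apply/measurable_EFinP; exact: measurable_funTS.
  rewrite [X in (X < _)%E](_ : _ = x^-1%:E) ?ltry//.
  by rewrite -integral_powR01//; apply: eq_integral => s _; rewrite /= ger0_norm ?powR_ge0.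
have mG : measurable_fun setT (fun s : R => s `^ (x - 1) * expR (- s)).
  by apply: measurable_funM => //; exact: measurable_expRN.
apply: Rintegral_gt0_on01 => //.
- by apply: subset_itvl; rewrite bnd_simp.
- apply: (@le_integrable _ _ _ mu _ _ _ (EFin \o (fun s => g1 s + expR (- s)))) => //.
  + by apply/measurable_EFinP; exact: measurable_funTS.
  + move=> s /=; rewrite in_itv/= andbT => s0.
    have g10 : 0 <= g1 s by rewrite /g1 patchE; case: ifP => // _; exact: powR_ge0.
    rewrite !ger0_norm ?lee_fin ?addr_ge0 ?mulr_ge0 ?powR_ge0 ?expR_ge0//.
    have [s1|s1] := ltP s 1.
      rewrite /g1 patchE ifT ?inE/= ?in_itv/= ?s0//.
      rewrite (@le_trans _ _ (s `^ (x - 1)))// ?lerDl ?expR_ge0//.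
      by rewrite ler_piMr ?powR_ge0// expR_le1 oppr_le0 ltW.
    rewrite (@le_trans _ _ (expR (- s)))// ?lerDr// ler_piMl ?expR_ge0//.
    by have := @ler_powRl_neg R (x - 1) 1 s; rewrite powR1 subr_le0; apply.
  + rewrite (_ : EFin \o _ = (EFin \o g1) \+ (EFin \o (fun s : R => expR (- s))))%E //.
    by apply: integrableD => //; exact: integrable_expRN.
- by move=> s _; rewrite mulr_ge0 ?powR_ge0 ?expR_ge0.
- by move=> s; rewrite in_itv/= => /andP[s0 _]; rewrite mulr_gt0 ?powR_gt0 ?expR_gt0.
Qed.

End GammaFacts.

(** * The substantial integral as a fractional integral *)
Section FracInt.
Context {R : realType}.
Variables sigma rho : R.
Hypothesis hrho : 0 < rho.
Implicit Types (a b c d t s l : R) (g psi : R -> R) (n j k m : nat).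
Notation mu := (@lebesgue_measure R).
Notation kpow := (clock_kernel rho).
Notation wpow := (clock_weight rho).
Notation RLint := (rl_integral rho).
Notation twist := (exp_clock sigma rho).

Definition frac_op a g t := if a == 0 then g t else (Gamma a)^-1 * RLint a g t.

Notation fracint := frac_op.

Lemma Isub_integrandE a psi g t s : 0 < s < t ->
  twist s * psi s = g s ->
  rho * (twist t * Isub_integrand sigma rho a psi t s) = kpow a t s * wpow s * g s.
Proof.
move=> /andP[s0 st] <-; rewrite /Isub_integrand /clock_kernel /clock_weight /exp_clock.
have -> : expR (- sigma * (t `^ rho - s `^ rho)) =
    expR (sigma * s `^ rho) / expR (sigma * t `^ rho).
  by rewrite -expRN -expRD; congr expR; ring.
have := expR_gt0 (sigma * t `^ rho).
move: (expR (sigma * t `^ rho)) (expR (sigma * s `^ rho)) => x y x0.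
by field; rewrite gt_eqF.
Qed.

(** The exponential of the integrand of Isub splits into exp_clock s, which is
    absorbed by g, and 1 / exp_clock t, which is cancelled. *)
Lemma twist_Isub a psi g t : 0 <= a -> 0 < t -> continuous g ->
  (forall s, 0 < s <= t -> twist s * psi s = g s) ->
  Isub_exists sigma rho a psi t /\
  twist t * Isub sigma rho a psi t = fracint a g t.
Proof.
move=> a0 t0 cg psig; rewrite /Isub_exists /Isub /fracint.
have [->|an0] := eqVneq a 0; first by split; [left|rewrite psig// t0 lexx].
have {an0}a0 : 0 < a by rewrite lt_neqAle eq_sym an0.
pose f := Isub_integrand sigma rho a psi t.
pose q s := (rho * twist t)^-1 * (kpow a t s * wpow s * g s).
have fq s : s \in `]0, t[ -> f s = q s.
  rewrite in_itv/= => s0t; rewrite /q -(@Isub_integrandE a psi g t s s0t); last first.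
    by move: s0t => /andP[s0 st]; rewrite psig// s0 ltW.
  by rewrite (mulrA rho) mulKf// mulf_neq0 ?twist_neq0// gt_eqF.
have iq : mu.-integrable `]0, t[ (EFin \o q).
  have := integrable_kernelM hrho t a0 (lexx 0) cg.
  move/(@integrableZl _ _ R mu _ (measurable_itv _) (rho * twist t)^-1 _).
  exact.
have iff : mu.-integrable `]0, t[ (EFin \o f).
  by apply: eq_integrable iq => // s; rewrite inE => st; rewrite /= fq.
have mf : measurable_fun `]0, t[ f by apply/measurable_EFinP; exact: measurable_int iff.
split.
  right; apply/integrableP; split.
    by apply/measurable_EFinP; exact: measurable_fun_itv_cc mf.
  rewrite integral_itv_bndoo; last first.
    by apply/measurable_EFinP; apply: measurableT_comp mf.
  by move/integrableP : iff => [].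
rewrite /Rintegral integral_itv_bndoo; last exact/measurable_EFinP.
rewrite -/(Rintegral mu `]0%R, t[%classic f).
have -> : \int[mu]_(s in `]0, t[) f s = \int[mu]_(s in `]0, t[) q s.
  by apply: eq_Rintegral => s; rewrite inE; exact: fq.
rewrite /q RintegralZl//; last exact: (integrable_kernelM hrho t a0 (lexx 0) cg).
rewrite -/(RLint a g t); have := twist_gt0 sigma rho t.
move: (exp_clock _ _ t) (rl_integral _ a g t) (Gamma a)^-1 => x y z x0.
by field; rewrite !gt_eqF.
Qed.

End FracInt.

(** * Inversion of the fractional integral *)
Section FracInverse.
Context {R : realType}.
Variables rho : R.
Hypothesis hrho : 0 < rho.
Implicit Types (a b c d t s l h beta alpha M T : R) (g psi F : R -> R) (n j k m : nat).
Notation RLint := (rl_integral rho).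
Notation I1 := (rl_integral rho 1).
Notation fracint := (frac_op rho).

(** Peel off one J^1 at a time; k, a product of inverses of Beta constants, is
    in effect the factorial of n. *)
Lemma RLint_nat n : exists2 k : R, 0 < k &
  forall F, continuous F -> forall t, RLint n.+1%:R F t = k * iter n.+1 I1 F t.
Proof.
elim: n => [|n [k k0 IH]]; first by exists 1 => // F cF t; rewrite mul1r.
exists ((Beta 1 n.+1%:R)^-1 * k); first by rewrite mulr_gt0// invr_gt0 Beta_gt0.
move=> F cF t; rewrite -[n.+2]add1n natrD (RLint_addl hrho t ltr01 (ltr0Sn R n) cF) -mulrA.
congr (_ * _).
rewrite [RHS](_ : _ = k * I1 (iter n.+1 I1 F) t)//.
rewrite -(RLintZ hrho k t ltr01 (continuous_iter_I1 hrho (n := n.+1) cF)).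
by apply: eq_RLint => s _; exact: IH.
Qed.

(** The two orders add up to the integer n.+1. If alpha is this integer,
    frac_op is the identity and the constant is the one of RLint_nat. *)
Lemma fracint_inverse n alpha : 0 < alpha -> alpha <= n.+1%:R -> n%:R < alpha ->
  exists2 c : R, 0 < c & forall F, continuous F -> forall t,
    fracint (n.+1%:R - alpha) (fun s => c * RLint alpha F s) t = iter n.+1 I1 F t.
Proof.
move=> a0 an na; have [k k0 kE] := RLint_nat n.
rewrite /frac_op; have [/eqP e|e0] := eqVneq (n.+1%:R - alpha) 0.
  move: e; rewrite subr_eq0 => /eqP e; exists k^-1; first by rewrite invr_gt0.
  by move=> F cF t; rewrite -e kE// mulKf// gt_eqF.
have g0 : 0 < n.+1%:R - alpha by rewrite lt_neqAle eq_sym e0 subr_ge0.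
have g1 : n.+1%:R - alpha <= 1 by rewrite -natr1; lra.
have G0 := Gamma_gt0 g0 g1; have B0 := Beta_gt0 g0 a0.
exists (Gamma (n.+1%:R - alpha) / (Beta (n.+1%:R - alpha) alpha * k)).
  by rewrite divr_gt0// mulr_gt0.
move=> F cF t; rewrite (RLintZ hrho _ _ g0 (continuous_RLint hrho a0 cF)).
rewrite (RLint_semigroup hrho t g0 a0 cF) subrK kE//.
move: G0 B0 k0; move: (Gamma _) (Beta _ _) (iter _ _ _ _) => x y z x0 y0 k0.
by field; rewrite !gt_eqF.
Qed.

Lemma continuous_eq0r h g1 g2 : 0 < h -> continuous g1 -> continuous g2 ->
  (forall t, 0 < t -> t <= h -> g1 t = g2 t) -> g1 0 = g2 0.
Proof.
move=> h0 c1 c2 g12.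
have r1 : g1 t @[t --> 0^'+] --> g1 0 by apply: cvg_at_right_filter; exact: c1.
have r2 : g2 t @[t --> 0^'+] --> g2 0 by apply: cvg_at_right_filter; exact: c2.
apply: (cvg_unique _ _ r2) => //; apply: (cvg_trans _ r1); apply: near_eq_cvg.
by apply: (near0_itv h0) => t t0 th; rewrite g12.
Qed.

(** Composing with the integral of order 1 - a gives the same antiderivative
    for g1 and g2; differentiate it. *)
Lemma fracint_inj h a g1 g2 : 0 < h -> 0 <= a -> a < 1 ->
  continuous g1 -> continuous g2 ->
  (forall t, 0 < t -> t <= h -> fracint a g1 t = fracint a g2 t) ->
  forall t, 0 <= t -> t <= h -> g1 t = g2 t.
Proof.
move=> h0 a0 a1 c1 c2 g12.
suff pos t : 0 < t -> t <= h -> g1 t = g2 t.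
  move=> t; rewrite le_eqVlt => /predU1P[<- _|]; last exact: pos.
  exact: (continuous_eq0r h0 c1 c2).
move: g12; rewrite /frac_op; have [_|an0] := eqVneq a 0; first exact.
move=> g12 t0 th.
have {an0}a0 : 0 < a by rewrite lt_neqAle eq_sym an0.
have b0 : 0 < 1 - a by rewrite subr_gt0.
have Gn0 : (Gamma a)^-1 != 0 by rewrite invr_eq0 gt_eqF// Gamma_gt0// ltW.
have eI s : 0 < s -> s <= h -> I1 g1 s = I1 g2 s.
  move=> s0 sh; have Bn0 : Beta (1 - a) a != 0 by rewrite gt_eqF// Beta_gt0.
  apply: (mulfI Bn0).
  have eB g : continuous g -> Beta (1 - a) a * I1 g s = RLint (1 - a) (RLint a g) s.
    by move=> cg; rewrite (RLint_semigroup hrho s b0 a0 cg) subrK.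
  rewrite (eB _ c1) (eB _ c2); apply: eq_RLint => r /andP[r0 rs].
  by apply: (mulfI Gn0); apply: g12 => //; rewrite (le_trans (ltW rs)).
have d1 := is_derive_has_derive_in h (is_derive_RLint1 hrho t0 c1).
have d2 := is_derive_has_derive_in h (is_derive_RLint1 hrho t0 c2).
have := has_derive_in_unique t0 th (eq_has_derive_in t0 th eI d1) d2.
by apply: mulfI; rewrite gt_eqF// wpow_gt0.
Qed.

Lemma RLint_cvg0 a F : 0 < a -> continuous F -> RLint a F t @[t --> 0^'+] --> 0.
Proof.
move=> a0 cF; rewrite -[X in _ --> X](RLint_le0 rho a F (lexx 0)).
by apply: cvg_at_right_filter; exact: continuous_RLint.
Qed.

Lemma RLintZ_cvg0 a c F : 0 < a -> continuous F ->
  c * RLint a F t @[t --> 0^'+] --> 0.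
Proof.
move=> a0 cF; have : c * RLint a F t @[t --> 0^'+] --> c * 0.
  by apply: cvgM; [exact: cvg_cst|exact: RLint_cvg0].
by rewrite mulr0.
Qed.

(** While the order exceeds 1, the integral of order beta is a multiple of J^1
    applied to the integral of order beta - 1. *)
Lemma RLint_delta_chain n beta c F : n%:R < beta -> continuous F ->
  exists G : nat -> R -> R,
  [/\ forall t, G 0%N t = c * RLint beta F t,
      forall d, delta_chain rho d n G &
      forall j, (j <= n)%N -> G j t @[t --> 0^'+] --> 0].
Proof.
move=> + cF; elim: n beta c => [|n IH] beta c nb.
  by exists (fun _ t => c * RLint beta F t); split => // j _; exact: RLintZ_cvg0.
have b0 : 0 < beta - 1 by move: nb; rewrite -natr1; have := ler0n R n; lra.
have [|G' [G0 dG cG]] := IH (beta - 1) (c * (Beta 1 (beta - 1))^-1).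
  by move: nb; rewrite -natr1; lra.
exists (fun j => if j is j'.+1 then G' j' else fun t => c * RLint beta F t); split.
- by [].
- move=> d; case=> [_ t t0 td|j jn t t0 td]; last exact: dG.
  have -> : (fun t => c * RLint beta F t) =
      (fun t => (c * (Beta 1 (beta - 1))^-1) * I1 (RLint (beta - 1) F) t).
    apply/funext => s; rewrite -mulrA -(RLint_addl hrho s ltr01 b0 cF).
    by rewrite addrC subrK.
  rewrite G0 mulrCA; apply: has_derive_inZ; apply: is_derive_has_derive_in.
  by apply: is_derive_RLint1 => //; exact: continuous_RLint.
- case=> [_|j jn]; last exact: cG.
  by apply: RLintZ_cvg0 => //; lra.
Qed.

Lemma iter_I1_delta_chain d n F : continuous F ->
  delta_chain rho d n (fun j => iter (n - j) I1 F).
Proof.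
move=> cF j jn t t0 td; rewrite subnS.
have -> : (n - j)%N = (n - j).-1.+1 by rewrite prednK// subn_gt0.
apply: is_derive_has_derive_in; apply: is_derive_RLint1 => //.
exact: continuous_iter_I1.
Qed.

Lemma iter_I1_bound n F M T : continuous F ->
  (forall t, 0 <= t <= T -> `|F t| <= M) ->
  forall t, 0 <= t -> t <= T -> `|iter n I1 F t| <= M * (Beta 1 1 * t `^ rho) ^+ n.
Proof.
move=> cF FM; elim: n => [|n IH] t t0 tT; first by rewrite expr0 mulr1 FM ?t0.
have M0 : 0 <= M by rewrite (le_trans (normr_ge0 _) (FM t _))// t0.
have B0 : 0 <= Beta 1 1 :> R by rewrite ltW// Beta_gt0.
have := @normr_RLint_le R rho hrho 1 (iter n I1 F) t (M * (Beta 1 1 * t `^ rho) ^+ n)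
   ltr01 t0 (continuous_iter_I1 hrho (n := n) cF).
rewrite powRr1 ?powR_ge0// -mulrA -exprSr => bd; apply: bd => s /andP[s0 st].
rewrite (le_trans (IH s (ltW s0) (le_trans (ltW st) tT)))//.
rewrite ler_wpM2l// lerXn2r ?nnegrE ?mulr_ge0 ?powR_ge0//.
by rewrite ler_wpM2l// ler_powRl ?(ltW hrho) ?(ltW s0) ?(ltW st).
Qed.

End FracInverse.

(** * The initial polynomial and the remainder *)
Section TaylorPoly.
Context {R : realType}.
Implicit Types (m j k : nat).

Definition taylor m (c : 'I_m -> R) : {poly R} :=
  \sum_(k < m) (c k / k`!%:R) *: 'X^k.

Lemma horner_taylor m (c : 'I_m -> R) u :
  (taylor c).[u] = \sum_(k < m) c k / k`!%:R * u ^+ k.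
Proof.
by rewrite /taylor horner_sum; apply: eq_bigr => k _; rewrite hornerZ hornerXn.
Qed.

Lemma taylor_derivn0 m (c : 'I_m -> R) (j : 'I_m) : ((taylor c)^`(j)).[0] = c j.
Proof.
rewrite horner_coef0 coef_derivn addn0 ffactnn /taylor coef_sum (bigD1 j)//=.
rewrite coefZ coefXn eqxx mulr1 big1 ?addr0 => [|i ij].
  by rewrite -(mulr_natr (_ / _)) divfK// pnatr_eq0 -lt0n fact_gt0.
by rewrite coefZ coefXn eq_sym (inj_eq val_inj) (negbTE ij) mulr0.
Qed.

End TaylorPoly.

(** Composition with clamp extends a function that is continuous on [0, h] to
    one that is continuous on the whole line, the class on which the fractional
    integral acts. *)
Section Clamp.
Context {R : realType}.
Variable h : R.
Hypothesis h0 : 0 < h.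
Implicit Types (t s : R) (g : R -> R).

Definition clamp t : R := Num.max 0 (Num.min t h).

Lemma clamp_id t : 0 <= t -> t <= h -> clamp t = t.
Proof. by move=> t0 th; rewrite /clamp min_l// max_r. Qed.

Lemma clamp_ge0 t : 0 <= clamp t.
Proof. by rewrite le_max lexx. Qed.

Lemma clamp_le t : clamp t <= h.
Proof. by rewrite ge_max (ltW h0) ge_min lexx orbT. Qed.

Lemma continuous_clamp : continuous clamp.
Proof.
move=> t.
have c1 : {for t, continuous (fun s : R => Num.min s h)}.
  by apply: continuous_min; [exact: cvg_id|exact: cvg_cst].
have c2 : {for t, continuous (fun _ : R => 0 : R)} by exact: cvg_cst.
exact: (continuous_max c2 c1).
Qed.

Lemma continuous_ext g : {within `[0, h], continuous g} -> continuous (g \o clamp).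
Proof.
move=> cg; apply: (continuous_comp_within cg continuous_clamp) => t.
by rewrite /= in_itv/= clamp_ge0 clamp_le.
Qed.

End Clamp.

Section TaylorRemainder.
Context {R : realType}.
Variables sigma rho h alpha : R.
Variable n : nat.
Hypothesis hrho : 0 < rho.
Hypothesis h0 : 0 < h.
Hypothesis alpha_le : alpha <= n.+1%:R.
Implicit Types (a d t s e M : R) (g psi F : R -> R) (j k : nat) (c : 'I_n.+1 -> R).
Notation fracint := (frac_op rho).
Notation twist := (exp_clock sigma rho).
Notation Dsub_at0 := (Dsub_at0 sigma rho h).
Notation a := (n.+1%:R - alpha).

Let a_ge0 : 0 <= a. Proof. by rewrite subr_ge0. Qed.

Lemma twist_caputo_corr psi t : 0 <= t ->
  twist t * caputo_corr sigma rho h n.+1 psi t =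
  twist t * psi t - (taylor (fun k : 'I_n.+1 => Dsub_at0 k psi)).[t `^ rho].
Proof.
move=> t0; rewrite /caputo_corr mulrBr horner_taylor; congr (_ - _).
rewrite mulr_sumr; apply: eq_bigr => k _.
rewrite mulNr expRN -/(twist t) powRrM powR_mulrn ?powR_ge0//.
by rewrite mulrC mulfVK// twist_neq0.
Qed.

Lemma near0_interval (P : R -> Prop) : (\forall t \near 0^'+, P t) ->
  exists2 d, 0 < d & d <= h /\ forall t, 0 < t -> t <= d -> P t.
Proof.
move=> [e /= e0 eP]; exists (Num.min (e / 2) h); first by rewrite lt_min divr_gt0.
split; first by rewrite ge_min lexx orbT.
move=> t t0; rewrite le_min => /andP[te _]; apply: eP => //=.
by rewrite sub0r normrN gtr0_norm//; move: te; lra.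
Qed.

Lemma poly_pow_small_eq0 (P : {poly R}) k : (size P <= k.+1)%N ->
  (forall e, 0 < e -> exists2 d, 0 < d &
    forall t, 0 < t -> t <= d -> `|P.[t `^ rho]| <= e * (t `^ rho) ^+ k) ->
  P = 0.
Proof.
move=> sP small; apply: (poly_small_eq0 sP) => e /small[d d0 hd].
exists (d `^ rho) => [|u u0 ud]; first exact: powR_gt0.
have rn0 : rho != 0 by rewrite gt_eqF.
have uE : (u `^ rho^-1) `^ rho = u by rewrite -powRrM mulVf// powRr1 ?ltW.
rewrite -[in X in X <= _]uE -[in X in _ <= X]uE; apply: hd; first exact: powR_gt0.
rewrite -[d]powRr1 ?(ltW d0)// -(mulfV rn0) powRrM.
by rewrite ler_powRl ?invr_ge0 ?(ltW hrho) ?(ltW u0).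
Qed.

Lemma taylor_delta_chain d c :
  delta_chain rho d n (fun j t => ((taylor c)^`(j)).[t `^ rho]).
Proof.
move=> j jn t t0 td; apply: is_derive_has_derive_in.
by rewrite derivnS; exact: is_derive_poly_pow.
Qed.

Lemma taylor_cvg0 c (j : 'I_n.+1) :
  ((taylor c)^`(j)).[t `^ rho] @[t --> 0^'+] --> c j.
Proof.
rewrite -taylor_derivn0.
have := cvg_comp _ _ (@powR_cvg0 R rho hrho) (@continuous_horner R (taylor c)^`(j) 0).
exact.
Qed.

(** The n-th derivative of the remainder tends to 0 at 0, hence is at most e
    near 0, and all lower ones vanish at 0. *)
Lemma taylor_remainder_small c psi :
  (forall k, (k < n.+1)%N -> Dsub_at0_exists sigma rho h k psi) ->
  (forall k : 'I_n.+1, Dsub_at0 k psi = c k) ->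
  forall e, 0 < e -> exists2 d, 0 < d & d <= h /\
    forall t, 0 < t -> t <= d ->
      `|twist t * psi t - (taylor c).[t `^ rho]| <= e * (t `^ rho) ^+ n.
Proof.
move=> ex psic e e0.
have [d1 d10 [d1h exd]] := near0_interval (ex n (ltnSn n)).1.
pose G j t := twist t * Dsub sigma rho h j psi t + (-1) * ((taylor c)^`(j)).[t `^ rho].
have cG : delta_chain rho d1 n G.
  move=> j jn t t0 td; rewrite /G mulrDr [X in _ + X]mulrCA.
  apply: has_derive_inD.
    exact: (Dsub_delta_chain hrho d1h exd jn t0 td).
  by apply: has_derive_inZ; exact: (taylor_delta_chain jn t0 td).
have G0 j : (j < n.+1)%N -> G j t @[t --> 0^'+] --> 0.
  move=> jn; have : G j t @[t --> 0^'+] --> 1 * c (Ordinal jn) + (-1) * c (Ordinal jn).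
    apply: cvgD; apply: cvgM.
    - exact: twist_cvg0.
    - by rewrite -psic; exact: (ex j jn).2.
    - exact: cvg_cst.
    - exact: (@taylor_cvg0 c (Ordinal jn)).
  by rewrite -mulrDl subrr mul0r.
have : \forall t \near 0^'+, `|G n t| <= e.
  have /cvgrPdist_le/(_ e e0) := G0 n (ltnSn n).
  by apply: filterS => t; rewrite sub0r normrN.
move=> /near0_interval[d2 d20 [d2h Gd2]].
exists (Num.min d1 d2); first by rewrite lt_min d10.
split; first by rewrite ge_min d1h.
move=> t t0; rewrite le_min => /andP[td1 td2].
have := @delta_chain_bound R rho hrho t n G e _ _ _ t t0 (lexx t).
rewrite /G /= mulN1r; apply.
- move=> j jn s s0 st; apply: (has_derive_in_le td1).
  by apply: cG => //; exact: le_trans td1.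
- by move=> s s0 st; apply: Gd2 => //; exact: le_trans td2.
- by move=> j jn; apply: G0; rewrite ltnS ltnW.
Qed.

Lemma fracint_bound g t M : 0 < t -> t <= 1 -> continuous g ->
  (forall s, 0 < s <= t -> `|g s| <= M) ->
  `|fracint a g t| <= (1 + `|(Gamma a)^-1| * Beta a 1) * M.
Proof.
move=> t0 t1 cg gM.
have M0 : 0 <= M by rewrite (le_trans (normr_ge0 _) (gM t _))// t0 lexx.
rewrite /frac_op; have [e|an0] := eqVneq a 0.
  by rewrite (le_trans (gM t _))// ?t0 ?lexx// ler_peMl// lerDl mulr_ge0// Beta_ge0.
have a0 : 0 < a by rewrite lt_neqAle eq_sym an0 a_ge0.
have B0 := Beta_gt0 a0 (@ltr01 R).
have h1 := normr_RLint_le hrho a0 (ltW t0) cg (M := M).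
rewrite normrM mulrDl mul1r -[leLHS]add0r lerD// -mulrA ler_wpM2l//.
rewrite mulrC (le_trans (h1 _))//; first by move=> s /andP[s0 st]; rewrite gM// s0 ltW.
rewrite ler_wpM2l// ler_piMr ?(ltW B0)//.
have th1 : t `^ rho <= 1 by have := ler_powRl (ltW hrho) (ltW t0) t1; rewrite powR1.
by have := ler_powRl (ltW a0) (powR_ge0 t rho) th1; rewrite powR1.
Qed.

End TaylorRemainder.

(** * Equivalence with the Volterra equation *)
Section VolterraEquivalence.
Context {R : realType}.
Variables sigma rho h alpha : R.
Variable n : nat.
Hypothesis hrho : 0 < rho.
Hypothesis h0 : 0 < h.
Hypothesis halpha : 0 < alpha.
Hypothesis alpha_le : alpha <= n.+1%:R.
Hypothesis alpha_gt : n%:R < alpha.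
Implicit Types (a d t s e M : R) (g psi F : R -> R) (j k : nat) (c : 'I_n.+1 -> R).
Notation RLint := (rl_integral rho).
Notation I1 := (rl_integral rho 1).
Notation fracint := (frac_op rho).
Notation twist := (exp_clock sigma rho).
Notation Dsub_at0 := (Dsub_at0 sigma rho h).
Notation a := (n.+1%:R - alpha).

Let a_ge0 : 0 <= a. Proof. by rewrite subr_ge0. Qed.
Let a_lt1 : a < 1. Proof. by move: alpha_gt; rewrite -natr1; lra. Qed.

Lemma within_continuous_remainder psi c : {within `[0, h], continuous psi} ->
  {within `[0, h], continuous (fun t => twist t * psi t - (taylor c).[t `^ rho])}.
Proof.
move=> cpsi.
have cp := within_continuous_powR_itv (b := h) hrho (lexx 0).
move=> t; apply: cvgB.
  apply: cvgM; last exact: cpsi.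
  apply: (@cvg_comp _ _ _ (@powR R ^~ rho) (fun u => expR (sigma * u)) _ (nbhs (t `^ rho))).
    exact: cp.
  apply: (@continuous_comp _ _ _ ( *%R sigma) expR); last exact: continuous_expR.
  by apply: cvgM; [exact: cvg_cst|exact: cvg_id].
apply: (@cvg_comp _ _ _ (@powR R ^~ rho) (fun u => (taylor c).[u]) _ (nbhs (t `^ rho))).
  exact: cp.
exact: continuous_horner.
Qed.

Variables (H : set (R * R)) (f : R * R -> R) (c0 : R).
Hypothesis c0P : forall F, continuous F -> forall t,
  fracint a (fun s => c0 * RLint alpha F s) t = iter n.+1 I1 F t.

(** See the introduction: integrate the equation n.+1 times, discard the
    polynomial because both integrals are o((t^rho)^n), and invert. *)
Lemma solution_volterra c psi F :
  is_solution sigma rho h alpha H f c psi -> continuous F ->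
  (forall t, 0 < t -> t <= h -> F t = twist t * f (t, psi t)) ->
  forall t, 0 <= t -> t <= h ->
    twist t * psi t = (taylor c).[t `^ rho] + c0 * RLint alpha F t.
Proof.
move=> [cpsi _ [ex exD] eqD psic] cF FE.
pose rem t := twist t * psi t - (taylor c).[t `^ rho].
pose g := rem \o clamp h.
have cg : continuous g by apply: continuous_ext => //; exact: within_continuous_remainder.
have gE t : 0 <= t -> t <= h -> g t = rem t by move=> t0 th; rewrite /g/= clamp_id.
have corrE t : 0 <= t -> t <= h ->
    twist t * caputo_corr sigma rho h n.+1 psi t = g t.
  move=> t0 th; rewrite twist_caputo_corr// gE// /rem; congr (_ - _.[_]).
  by apply: eq_bigr => k _; rewrite psic.
have fE t : 0 < t -> t <= h ->
    twist t * Isub sigma rho a (caputo_corr sigma rho h n.+1 psi) t = fracint a g t.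
  move=> t0 th; apply: (twist_Isub hrho a_ge0 t0 cg _).2 => s /andP[s0 st].
  by apply: corrE; rewrite ?(ltW s0) ?(le_trans st).
have chain : delta_chain rho h n.+1 (fun j t => twist t *
    Dsub sigma rho h j (Isub sigma rho a (caputo_corr sigma rho h n.+1 psi)) t).
  apply: (Dsub_delta_chain hrho (lexx h)) => t t0 th.
  have th' : t \in `]0, h] by rewrite in_itv/= t0.
  exact: (exD t th').2.
have [P sP PE] : exists2 P : {poly R}, (size P <= n.+1)%N &
    forall t, 0 < t -> t <= h -> fracint a g t = iter n.+1 I1 F t + P.[t `^ rho].
  have [t t0 th|P sP PE] := delta_chain_integrate hrho h0 chain cF.
    rewrite FE//; congr (_ * _); apply: eqD.
    by rewrite in_itv/= t0.
  by exists P => // t t0 th; rewrite -fE//; exact: PE.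
have P0 : P = 0.
  apply: (poly_pow_small_eq0 hrho sP) => e e0.
  pose K := 1 + `|(Gamma a)^-1| * Beta a 1.
  have K0 : 0 < K by rewrite ltr_wpDr// mulr_ge0// Beta_ge0.
  have e2K : 0 < e / 2 / K by rewrite !divr_gt0.
  have [d d0 [dh gd]] := taylor_remainder_small hrho h0 ex psic e2K.
  have [M M0 FM] := continuous_bounded_itv h cF.
  have B0 : 0 < Beta 1 1 :> R by exact: Beta_gt0.
  pose N := M * Beta 1 1 ^+ n.+1 + 1.
  have N0 : 0 < N by rewrite ltr_wpDl// mulr_ge0// exprn_ge0// ltW.
  pose d' := Num.min (Num.min d 1) ((e / 2 / N) `^ rho^-1).
  have d'0 : 0 < d' by rewrite !lt_min d0 ltr01 powR_gt0// !divr_gt0.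
  exists d' => // t t0; rewrite !le_min => /andP[/andP[td t1] tN].
  have th : t <= h by exact: le_trans dh.
  have u0 := powR_ge0 t rho.
  have uN : t `^ rho * N <= e / 2.
    rewrite -ler_pdivlMr//; have := ler_powRl (ltW hrho) (ltW t0) tN.
    by rewrite -powRrM mulVf ?gt_eqF// powRr1// ltW// !divr_gt0.
  have b1 : `|fracint a g t| <= K * (e / 2 / K * (t `^ rho) ^+ n).
    apply: (fracint_bound hrho alpha_le t0 t1 cg) => s /andP[s0 st].
    rewrite gE ?(ltW s0)// ?(le_trans st)//.
    rewrite (le_trans (gd s s0 (le_trans st td)))//.
    rewrite ler_wpM2l ?(ltW e2K)// lerXn2r ?nnegrE ?powR_ge0//.
    by rewrite ler_powRl ?(ltW hrho) ?(ltW s0).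
  have b2 : `|iter n.+1 I1 F t| <= M * (Beta 1 1 * t `^ rho) ^+ n.+1.
    by apply: (iter_I1_bound hrho n.+1 cF FM) => //; exact: ltW.
  have -> : P.[t `^ rho] = fracint a g t - iter n.+1 I1 F t.
    by rewrite PE// addrAC subrr add0r.
  rewrite (le_trans (ler_normB _ _))// (le_trans (lerD b1 b2))//.
  have -> : K * (e / 2 / K * (t `^ rho) ^+ n) = e / 2 * (t `^ rho) ^+ n.
    by rewrite mulrA (mulrC K) divfK// gt_eqF.
  have -> : M * (Beta 1 1 * t `^ rho) ^+ n.+1 =
      (M * Beta 1 1 ^+ n.+1 * t `^ rho) * (t `^ rho) ^+ n.
    by rewrite exprMn [(t `^ rho) ^+ n.+1]exprS !mulrA.
  rewrite -mulrDl ler_wpM2r ?exprn_ge0//.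
  have : M * Beta 1 1 ^+ n.+1 * t `^ rho <= t `^ rho * N.
    by rewrite mulrC /N mulrDr mulr1 lerDl.
  lra.
have gV : forall t, 0 <= t -> t <= h -> g t = c0 * RLint alpha F t.
  apply: (fracint_inj hrho h0 a_ge0 a_lt1 cg).
    move=> t; apply: cvgM; first exact: cvg_cst.
    exact: continuous_RLint.
  by move=> t t0 th; rewrite c0P// PE// P0 horner0 addr0.
move=> t t0 th; rewrite -gV// gE// /rem.
by rewrite addrC subrK.
Qed.

(** The derivatives of psi at 0 come from the initial polynomial, since those
    of J^alpha F of order <= n are fractional integrals of positive order. *)
Lemma volterra_solution c psi F :
  {within `[0, h], continuous psi} ->
  (forall t, 0 <= t -> t <= h -> H (t, psi t)) ->
  continuous F ->
  (forall t, 0 < t -> t <= h -> F t = twist t * f (t, psi t)) ->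
  (forall t, 0 <= t -> t <= h ->
    twist t * psi t = (taylor c).[t `^ rho] + c0 * RLint alpha F t) ->
  is_solution sigma rho h alpha H f c psi.
Proof.
move=> cpsi psiH cF FE psiE.
have [G [G0 dG cG]] := RLint_delta_chain hrho c0 alpha_gt cF.
have at0 k : (k < n.+1)%N -> forall cl, cl = c (inord k) ->
    Dsub_at0_exists sigma rho h k psi /\ Dsub_at0 k psi = cl.
  move=> kn cl ->.
  apply: (@Dsub_at0_delta_chain R sigma rho h hrho h0 k n psi
    (fun j t => ((taylor c)^`(j)).[t `^ rho] + G j t)).
  - by move=> t t0 th; rewrite psiE ?(ltW t0)// G0.
  - move=> j jn t t0 td; rewrite mulrDr.
    by apply: has_derive_inD; [exact: (taylor_delta_chain jn t0 td)|exact: (dG h j jn t t0 td)].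
  - exact: kn.
  - rewrite -[X in _ --> X]addr0; apply: cvgD; last exact: cG.
    by have := @taylor_cvg0 R rho n hrho c (inord k); rewrite inordK.
have psic (k : 'I_n.+1) : Dsub_at0 k psi = c k.
  by have [] := at0 k (ltn_ord k) _ erefl; rewrite inord_val.
pose g t := c0 * RLint alpha F t.
have cg : continuous g.
  move=> t; apply: cvgM; first exact: cvg_cst.
  exact: continuous_RLint.
have corrE t : 0 <= t -> t <= h ->
    twist t * caputo_corr sigma rho h n.+1 psi t = g t.
  move=> t0 th; rewrite twist_caputo_corr// psiE// /g.
  rewrite (_ : taylor _ = taylor c) ?[_ + c0 * _]addrC ?addrK//.
  by apply: eq_bigr => k _; rewrite psic.
have tI t : 0 < t -> t <= h ->
    Isub_exists sigma rho a (caputo_corr sigma rho h n.+1 psi) t /\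
    twist t * Isub sigma rho a (caputo_corr sigma rho h n.+1 psi) t = fracint a g t.
  move=> t0 th; apply: (twist_Isub hrho a_ge0 t0 cg) => s /andP[s0 st].
  by apply: corrE; rewrite ?(ltW s0) ?(le_trans st).
have DE t : 0 < t -> t <= h -> Dsub sigma rho h n.+1
      (Isub sigma rho a (caputo_corr sigma rho h n.+1 psi)) t = f (t, psi t) /\
    Dsub_exists sigma rho h n.+1 (Isub sigma rho a (caputo_corr sigma rho h n.+1 psi)) t.
  move=> t0 th.
  have [| -> ex] := delta_chain_Dsub hrho _ (@iter_I1_delta_chain R rho hrho h n.+1 F cF)
      (leqnn n.+1) t0 th (sigma := sigma) (g := Isub sigma rho a (caputo_corr sigma rho h n.+1 psi)).
    by move=> s s0 sh; rewrite (tI s s0 sh).2 subn0 c0P.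
  split => //; rewrite subnn /= FE// mulKf// twist_neq0.
  by [].
split => //.
- by move=> t; rewrite in_itv/= => /andP[t0 th]; exact: psiH.
- split; first by move=> k kn; have [] := at0 k kn _ erefl.
  by move=> t; rewrite in_itv/= => /andP[t0 th]; split; [exact: (tI t t0 th).1|exact: (DE t t0 th).2].
- by move=> t; rewrite in_itv/= => /andP[t0 th]; exact: (DE t t0 th).1.
Qed.

End VolterraEquivalence.

(** * Contraction on continuous functions *)
Section FixedPoint.
Context {R : realType}.
Variable h : R.
Hypothesis h0 : 0 < h.

(** Picard iteration in the supremum norm of [0, h]; composing with clamp turns
    the limit into a function that is continuous everywhere. *)
Lemma halving_fixed_point (Op : (R -> R) -> R -> R) :
  (forall psi, continuous psi -> continuous (Op psi)) ->
  (forall psi1 psi2 D, continuous psi1 -> continuous psi2 ->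
    (forall t, 0 <= t -> t <= h -> `|psi1 t - psi2 t| <= D) ->
    forall t, 0 <= t -> t <= h -> `|Op psi1 t - Op psi2 t| <= D / 2) ->
  exists2 psi, continuous psi & forall t, 0 <= t -> t <= h -> psi t = Op psi t.
Proof.
move=> cOp half.
pose u k := iter k Op (fun=> 0).
have cu k : continuous (u k).
  elim: k => [|k IH]; last exact: cOp.
  by move=> t; exact: (@cvg_cst R 0).
have [D D0 uD] : exists2 D : R, 0 <= D & forall t, 0 <= t <= h -> `|u 1%N t - u 0%N t| <= D.
  by apply: continuous_bounded_itv => t; apply: cvgB; exact: cu.
pose r k : R := D / 2 ^+ k.
have r0 k : 0 <= r k by rewrite divr_ge0// exprn_ge0.
have rS k : r k.+1 = r k / 2 by rewrite /r exprSr invfM mulrA.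
have step k t : 0 <= t -> t <= h -> `|u k.+1 t - u k t| <= r k.
  elim: k t => [|k IH] t t0 th; first by rewrite /r expr0 divr1 uD// t0.
  by rewrite rS; exact: half (cu k.+1) (cu k) IH t t0 th.
have far j k t : 0 <= t -> t <= h -> `|u (k + j)%N t - u k t| <= r k *+ 2.
  move=> t0 th; elim: j k => [|j IH] k.
    by rewrite addn0 subrr normr0 mulrn_wge0.
  rewrite addnS -addSn (le_trans (ler_distD (u k.+1 t) _ _))//.
  rewrite (le_trans (lerD (IH k.+1) (step k t t0 th)))// rS.
  by move: (r k) => x; lra.
have small e : 0 < e -> exists k, r k *+ 2 < e.
  move=> e0; have : (geometric (D *+ 2) (2^-1) k @[k --> \oo] --> (0 : R)).
    by apply: cvg_geometric; rewrite ger0_norm ?invr_ge0// invf_lt1// ltr1n.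
  move=> /cvgrPdist_lt/(_ e e0)[k _ /(_ k (leqnn k))].
  rewrite sub0r normrN => hk; exists k; apply: le_lt_trans hk.
  by rewrite (le_trans _ (ler_norm _))// /geometric/= /r exprVn mulrnAl.
pose v t := lim (u k t @[k --> \oo]).
have cvu t : 0 <= t -> t <= h -> cvg (u k t @[k --> \oo]).
  move=> t0 th; apply: cauchy_cvg; apply: cauchy_exP => e e0.
  have [k ke] := small e e0; exists (u k t); exists k => // i /= ki.
  rewrite -ball_normE /= distrC -(subnKC ki).
  by apply: le_lt_trans ke; exact: far.
have vu k t : 0 <= t -> t <= h -> `|v t - u k t| <= r k *+ 2.
  move=> t0 th; have cn : `|u j t - u k t| @[j --> \oo] --> `|v t - u k t|.
    by apply: cvg_norm; apply: cvgB; [exact: cvu|exact: cvg_cst].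
  apply: (cvgr_to_le cn); exists k => // j /= kj.
  by rewrite -(subnKC kj); exact: far.
have cv : continuous (v \o clamp h).
  move=> x; apply/cvgrPdist_lt => e e0.
  have e3 : 0 < e / 3 by rewrite divr_gt0.
  have [k ke] := small _ e3.
  have cuk : {for x, continuous (u k \o clamp h)}.
    by apply: continuous_comp; [exact: continuous_clamp|exact: cu].
  move/cvgrPdist_lt : cuk => /(_ _ e3); apply: filterS => y /= uxy.
  have b1 := vu k (clamp h x) (clamp_ge0 h x) (clamp_le h0 x).
  have b2 := vu k (clamp h y) (clamp_ge0 h y) (clamp_le h0 y).
  move: b1 b2 uxy; move: (v _) (v _) (u k _) (u k _) => a b c d.
  rewrite !ler_norml !ltr_norml; move: (r k *+ 2) ke => z; lra.
exists (v \o clamp h) => //.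
move=> t t0 th; apply/eqP; rewrite -subr_eq0 -normr_eq0; apply/negPn/negP => n0.
have {}n0 : 0 < `|(v \o clamp h) t - Op (v \o clamp h) t| by rewrite lt_neqAle eq_sym n0 normr_ge0.
have [k ke] := small _ n0.
have hv s : 0 <= s -> s <= h -> `|u k s - (v \o clamp h) s| <= r k *+ 2.
  by move=> s0 sh; rewrite /= clamp_id// distrC; exact: vu.
have b1 : `|u k.+1 t - Op (v \o clamp h) t| <= (r k *+ 2) / 2.
  exact: half (cu k) cv hv t t0 th.
have b2 : `|(v \o clamp h) t - u k.+1 t| <= r k.+1 *+ 2.
  by move: (vu k.+1 t t0 th); rewrite -[in v t](clamp_id t0 th).
have := le_trans (ler_distD (u k.+1 t) _ _) (lerD b2 b1).
rewrite rS (_ : (r k / 2) *+ 2 + r k *+ 2 / 2 = r k *+ 2); last first.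
  by move: (r k) => x; lra.
by rewrite leNgt ke.
Qed.

End FixedPoint.

(** * The Volterra equation for a Lipschitz right-hand side *)
Section VolterraEquation.
Context {R : realType}.
Variables sigma rho h alpha c0 L : R.
Variable n : nat.
Hypothesis hsigma : 0 < sigma.
Hypothesis hrho : 0 < rho.
Hypothesis h0 : 0 < h.
Hypothesis h1 : h <= 1.
Hypothesis halpha : 0 < alpha.
Hypothesis c00 : 0 < c0.
Implicit Types (d t s e A y : R) (psi phi F : R -> R) (j k : nat) (c : 'I_n.+1 -> R).
Notation RLint := (rl_integral rho).
Notation twist := (exp_clock sigma rho).

(** The norm bound of the map F |-> c0 * J^alpha F on [0, h]; it tends to 0
    with h. *)
Definition contraction : R := c0 * (Beta alpha 1 * (h `^ rho) `^ alpha).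

Lemma twist_le s t : 0 <= s -> s <= t -> twist s <= twist t.
Proof.
by move=> s0 st; rewrite ler_expR ler_wpM2l ?(ltW hsigma)// ler_powRl ?(ltW hrho).
Qed.

Lemma twist_ge1 t : 0 <= t -> 1 <= twist t.
Proof.
by move=> t0; rewrite -expR0 ler_expR mulr_ge0 ?powR_ge0 ?(ltW hsigma).
Qed.

Lemma untwist_le t x : 0 <= t -> `|(twist t)^-1 * x| <= `|x|.
Proof.
move=> t0; rewrite normrM ler_piMl// ger0_norm ?invr_ge0 ?(ltW (twist_gt0 _ _ _))//.
by rewrite invf_le1 ?twist_gt0// twist_ge1.
Qed.

(** As exp_clock is nondecreasing, the weight of F at s < t is cancelled by the
    factor 1 / exp_clock t. *)
Lemma untwist_RLint_le F A t : continuous F -> 0 <= t -> t <= h -> 0 <= A ->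
  (forall s, 0 < s < t -> `|F s| <= twist s * A) ->
  `|(twist t)^-1 * (c0 * RLint alpha F t)| <= contraction * A.
Proof.
move=> cF t0 th A0 FA.
have T0 := twist_gt0 sigma rho t.
have B0 := Beta_gt0 halpha (@ltr01 R).
have bd : `|RLint alpha F t| <= (twist t * A) * (Beta alpha 1 * (t `^ rho) `^ alpha).
  apply: (normr_RLint_le hrho halpha t0 cF) => s /andP[s0 st].
  apply: le_trans (FA s _) _; first by rewrite s0.
  exact: ler_wpM2r A0 _ _ (twist_le (ltW s0) (ltW st)).
have pw : (t `^ rho) `^ alpha <= (h `^ rho) `^ alpha.
  by rewrite ler_powRl ?powR_ge0 ?(ltW halpha)// ler_powRl ?(ltW hrho).
rewrite !normrM (gtr0_norm c00) ger0_norm ?invr_ge0 ?(ltW T0)//.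
rewrite mulrC ler_pdivrMr//.
rewrite (le_trans (ler_wpM2l (ltW c00) bd))// /contraction.
rewrite [leRHS](_ : _ = c0 * (twist t * A * (Beta alpha 1 * (h `^ rho) `^ alpha))); last by ring.
apply: ler_wpM2l (ltW c00) _ _ _; apply: ler_wpM2l.
  exact: mulr_ge0 (ltW T0) A0.
exact: ler_wpM2l (ltW B0) _ _ pw.
Qed.

Variable ftil : R -> R -> R.

(** The function F of the Volterra equation, extended beyond [0, h]. *)
Definition forcing psi t := twist (clamp h t) * ftil (clamp h t) (psi (clamp h t)).

Hypothesis forcing_continuous : forall psi, {within `[0, h], continuous psi} ->
  continuous (forcing psi).
Hypothesis L0 : 0 <= L.
Hypothesis ftil_lip : forall t y y', 0 <= t -> t <= h ->
  `|ftil t y - ftil t y'| <= L * `|y - y'|.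
Hypothesis contractionL : contraction * L <= 2^-1.

Definition volterra c psi : Prop := forall t, 0 <= t -> t <= h ->
  twist t * psi t = (taylor c).[t `^ rho] + c0 * RLint alpha (forcing psi) t.

Definition volterra_op c psi t : R := (twist t)^-1 *
  ((taylor c).[t `^ rho] + c0 * RLint alpha (forcing psi) t).

Lemma volterraE c psi t : volterra c psi -> 0 <= t -> t <= h ->
  psi t = volterra_op c psi t.
Proof. by move=> V t0 th; rewrite /volterra_op -V// mulKf// twist_neq0. Qed.

Lemma volterra_op_increment psi phi D :
  {within `[0, h], continuous psi} -> {within `[0, h], continuous phi} ->
  (forall t, 0 <= t -> t <= h -> `|psi t - phi t| <= D) ->
  forall t, 0 <= t -> t <= h ->
  `|(twist t)^-1 * (c0 * (RLint alpha (forcing psi) t - RLint alpha (forcing phi) t))| <= D / 2.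
Proof.
move=> cpsi cphi pD t t0 th.
have D0 : 0 <= D by rewrite (le_trans (normr_ge0 _) (pD t t0 th)).
have c1 := forcing_continuous cpsi; have c2 := forcing_continuous cphi.
have -> : RLint alpha (forcing psi) t - RLint alpha (forcing phi) t =
    RLint alpha (fun s => -1 * forcing phi s + forcing psi s) t.
  by rewrite (RLint_linear hrho _ t halpha c2 c1) mulN1r addrC.
have cd : continuous (fun s => -1 * forcing phi s + forcing psi s).
  move=> s; apply: cvgD; last exact: c1.
  by apply: cvgM; [exact: cvg_cst|exact: c2].
rewrite (@le_trans _ _ (contraction * (L * D)))//.
  apply: untwist_RLint_le => //; first exact: mulr_ge0.
  move=> s /andP[s0 st]; have sh : s <= h by rewrite (le_trans (ltW st)).
  rewrite /forcing clamp_id ?(ltW s0)// mulN1r addrC -mulrBr normrM.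
  rewrite (gtr0_norm (twist_gt0 _ _ _)) ler_wpM2l ?(ltW (twist_gt0 _ _ _))//.
  by rewrite (le_trans (ftil_lip _ _ (ltW s0) sh))// ler_wpM2l// pD// ltW.
by rewrite mulrA mulrC ler_wpM2l.
Qed.

Lemma volterra_op_continuous c psi : {within `[0, h], continuous psi} ->
  continuous (volterra_op c psi \o clamp h).
Proof.
move=> cpsi.
have cth : continuous (fun t => clamp h t `^ rho).
  exact: (continuous_ext h0 (within_continuous_powR_itv hrho (lexx 0))).
move=> t; apply: cvgM.
  apply: cvgV; first by rewrite twist_neq0.
  apply: (@continuous_comp _ _ _ (fun t => sigma * clamp h t `^ rho) expR); last exact: continuous_expR.
  by apply: cvgM; [exact: cvg_cst|exact: cth].
apply: cvgD.
  apply: (@continuous_comp _ _ _ (fun t => clamp h t `^ rho) (fun u => (taylor c).[u])).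
    exact: cth.
  exact: continuous_horner.
apply: cvgM; first exact: cvg_cst.
apply: (@continuous_comp _ _ _ (clamp h) (RLint alpha (forcing psi))).
  exact: continuous_clamp.
by apply: continuous_RLint => //; exact: forcing_continuous.
Qed.

Lemma volterra_exists c : exists2 psi, continuous psi & volterra c psi.
Proof.
have [||psi cpsi psiE] := halving_fixed_point h0 (Op := fun psi => volterra_op c psi \o clamp h).
- by move=> psi cpsi; apply: volterra_op_continuous; exact: continuous_subspaceT.
- move=> psi phi D cpsi cphi pD t t0 th; rewrite /= clamp_id// /volterra_op.
  rewrite -mulrBr [X in _ * X](_ : _ = c0 * (RLint alpha (forcing psi) t - RLint alpha (forcing phi) t)).
    by apply: volterra_op_increment => //; exact: continuous_subspaceT.
  by rewrite mulrBr opprD addrACA subrr add0r.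
exists psi => // t t0 th.
by rewrite psiE//= clamp_id// /volterra_op mulVKf// twist_neq0.
Qed.

Lemma taylor_dist c (d : 'I_n.+1 -> R) e u : 0 <= u -> u <= 1 -> 0 <= e ->
  (forall k : 'I_n.+1, `|c k - d k| <= e) ->
  `|(taylor c).[u] - (taylor d).[u]| <= n.+1%:R * e.
Proof.
move=> u0 u1 e0 ecd; rewrite !horner_taylor -sumrB.
rewrite (le_trans (ler_norm_sum _ _ _))//.
rewrite (le_trans (ler_sum _ (G := fun=> e) _))//; last first.
  by rewrite sumr_const card_ord mulr_natl.
move=> k _; rewrite -!mulrBl !normrM normfV (ger0_norm (exprn_ge0 _ u0)) normr_nat.
apply: le_trans (ecd k); rewrite -mulrA ler_piMr// mulr_ile1 ?exprn_ge0 ?exprn_ile1//.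
by rewrite invf_le1 ?ltr0n ?ler1n fact_gt0.
Qed.

(** At a maximum point of |psi - phi| the two equations bound the maximum D by
    n.+1 * e + D / 2. *)
Lemma volterra_stable c (d : 'I_n.+1 -> R) e psi phi :
  {within `[0, h], continuous psi} -> {within `[0, h], continuous phi} ->
  volterra c psi -> volterra d phi -> 0 <= e -> (forall k : 'I_n.+1, `|c k - d k| <= e) ->
  forall t, 0 <= t -> t <= h -> `|psi t - phi t| <= 2 * n.+1%:R * e.
Proof.
move=> cpsi cphi Vc Vd e0 ecd.
have cdif : {within `[0, h], continuous (fun t => `|psi t - phi t|)}.
  by move=> t; apply: cvg_norm; apply: cvgB; [exact: cpsi|exact: cphi].
have [t1 t1h tmax] := EVT_max (ltW h0) cdif.
move: t1h; rewrite in_itv/= => /andP[t10 t1h].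
set D := `|psi t1 - phi t1| in tmax.
have pD t : 0 <= t -> t <= h -> `|psi t - phi t| <= D.
  by move=> t0 th; apply: tmax; rewrite in_itv/= t0.
suff DE : D <= 2 * n.+1%:R * e by move=> t t0 th; rewrite (le_trans (pD t t0 th)).
have u1 : t1 `^ rho <= 1.
  by have := ler_powRl (ltW hrho) t10 (le_trans t1h h1); rewrite powR1.
have b1 := taylor_dist (powR_ge0 t1 rho) u1 e0 ecd.
have b2 := volterra_op_increment cpsi cphi pD t10 t1h.
have : D <= n.+1%:R * e + D / 2.
  rewrite {1}/D (volterraE Vc t10 t1h) (volterraE Vd t10 t1h) /volterra_op -mulrBr.
  rewrite opprD addrACA -mulrBr mulrDr (le_trans (ler_normD _ _))//.
  by rewrite lerD// (le_trans (untwist_le _ t10)).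
by rewrite -mulrA; move: (n.+1%:R * e) => x; lra.
Qed.

End VolterraEquation.

(** * Extension of the right-hand side beyond the tube *)
Section Clip.
Context {R : realType}.
Variable K : R.
Hypothesis K0 : 0 < K.
Implicit Types z : R.

Definition clip z : R := Num.max (- K) (Num.min z K).

Lemma clip_id z : `|z| <= K -> clip z = z.
Proof. by rewrite ler_norml => /andP[z1 z2]; rewrite /clip min_l// max_r. Qed.

Lemma normr_clip z : `|clip z| <= K.
Proof.
rewrite ler_norml le_max lexx/= ge_max ge_min lexx orbT andbT.
by move: K0; lra.
Qed.

Lemma clip_lip z z' : `|clip z - clip z'| <= `|z - z'|.
Proof.
have a1 := ler_norm (z - z'); have := ler_norm (z' - z); rewrite distrC => a2.
have clipE x : clip x = if x <= - K then - K else if K <= x then K else x.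
  have k0 := K0; rewrite /clip; case: (leP x (- K)) => x1.
    by rewrite min_l ?max_l//; lra.
  by case: (leP K x) => x2; rewrite max_r//; lra.
rewrite ler_norml !clipE; move: `|z - z'| a1 a2 => d a1 a2; have k0 := K0.
case: (leP z (- K)) => y1; case: (leP z' (- K)) => y2;
  case: (leP K z) => y3; case: (leP K z') => y4; apply/andP; split; lra.
Qed.

Lemma continuous_clip : continuous clip.
Proof.
move=> x; apply/cvgrPdist_lt => e e0; exists e => //= y xy.
by rewrite (le_lt_trans (clip_lip _ _)).
Qed.

End Clip.

Section Tube.
Context {R : realType}.
Variables sigma rho hstar K h : R.
Variable n : nat.
Variable b : 'I_n.+1 -> R.
Variable f : R * R -> R.
Hypothesis hrho : 0 < rho.
Hypothesis K0 : 0 < K.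
Hypothesis h0 : 0 < h.
Hypothesis hle : h <= hstar.
Notation H := (Hset sigma rho hstar K b).
Hypothesis fcont : {within H, continuous f}.
Notation twist := (exp_clock sigma rho).

Definition tube_poly : {poly R} :=
  \sum_(k < n.+1) (b k / Gamma (k%:R + 1)) *: 'X^k.

Definition tube_center t : R := expR (- sigma * t `^ rho) * tube_poly.[t `^ rho].

Notation center := tube_center.

Lemma HsetP t y : 0 <= t -> H (t, y) <-> t <= hstar /\ `|y - center t| <= K.
Proof.
move=> t0; rewrite /Hset /= t0/= (_ : expR _ * _ = center t) //.
rewrite /center /tube_poly horner_sum; congr (_ * _); apply: eq_bigr => k _.
by rewrite hornerZ hornerXn powRrM powR_mulrn// powR_ge0.
Qed.

Definition clipped_field t y : R := f (t, center t + clip K (y - center t)).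

Notation clipped := clipped_field.

Lemma clip_Hset t y : 0 <= t -> t <= hstar -> H (t, center t + clip K (y - center t)).
Proof.
by move=> t0 th; apply/HsetP => //; split=> //; rewrite addrAC subrr add0r normr_clip.
Qed.

Lemma clipped_id t y : 0 <= t -> H (t, y) -> clipped t y = f (t, y).
Proof.
by move=> t0 /(HsetP _ t0)[th yK]; rewrite /clipped clip_id// addrC subrK.
Qed.

(** The clipped graph stays in H, the only set where f is continuous. *)
Lemma clipped_forcing_continuous psi : {within `[0, h], continuous psi} ->
  continuous (forcing sigma rho h clipped psi).
Proof.
move=> cpsi.
have cth : continuous (fun t => clamp h t `^ rho).
  exact: (continuous_ext h0 (within_continuous_powR_itv hrho (lexx 0))).
have cexp c : continuous (fun t => expR (c * clamp h t `^ rho)).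
  move=> t; apply: (@continuous_comp _ _ _ (fun t => c * clamp h t `^ rho) expR); last exact: continuous_expR.
  by apply: cvgM; [exact: cvg_cst|exact: cth].
have cctr : continuous (center \o clamp h).
  move=> t; apply: cvgM; first exact: cexp.
  apply: (@continuous_comp _ _ _ (fun t => clamp h t `^ rho) (fun u => tube_poly.[u])).
    exact: cth.
  exact: continuous_horner.
have cpsi' := continuous_ext h0 cpsi.
pose g2 t := center (clamp h t) + clip K (psi (clamp h t) - center (clamp h t)).
have cg2 : continuous g2.
  move=> t; apply: cvgD; first exact: cctr.
  apply: (@continuous_comp _ _ _ (fun t => psi (clamp h t) - center (clamp h t)) (clip K)); last exact: continuous_clip.
  by apply: cvgB; [exact: cpsi'|exact: cctr].
pose g t := (clamp h t, g2 t).
have cg : continuous g by move=> t; exact: (cvg_pair (@continuous_clamp R h t) (cg2 t)).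
have cfg : continuous (f \o g).
  apply: (continuous_comp_within fcont cg) => t; apply: clip_Hset.
    exact: clamp_ge0.
  by rewrite (le_trans (clamp_le h0 t)).
by move=> t; apply: cvgM; [exact: cexp|exact: cfg].
Qed.

End Tube.

(** * The initial value problem *)
Section InitialValueProblem.
Context {R : realType}.
Variables sigma rho alpha K hstar L M h c0 : R.
Variable n : nat.
Variables (b : 'I_n.+1 -> R) (f : R * R -> R).
Hypothesis hsigma : 0 < sigma.
Hypothesis hrho : 0 < rho.
Hypothesis halpha : 0 < alpha.
Hypothesis alpha_le : alpha <= n.+1%:R.
Hypothesis alpha_gt : n%:R < alpha.
Hypothesis K0 : 0 < K.
Notation H := (Hset sigma rho hstar K b).
Notation center := (tube_center sigma rho b).
Notation clipped := (clipped_field sigma rho K b f).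
Notation twist := (exp_clock sigma rho).
Hypothesis fcont : {within H, continuous f}.
Hypothesis fM : forall p, H p -> `|f p| <= M.
Hypothesis L0 : 0 <= L.
Hypothesis flip : forall t y y' : R, H (t, y) -> H (t, y') ->
  `|f (t, y) - f (t, y')| <= L * `|y - y'|.
Hypothesis c00 : 0 < c0.
Hypothesis c0P : forall F, continuous F -> forall t,
  frac_op rho (n.+1%:R - alpha) (fun s => c0 * rl_integral rho alpha F s) t =
  iter n.+1 (rl_integral rho 1) F t.
Hypothesis h0 : 0 < h.
Hypothesis h1 : h <= 1.
Hypothesis hle : h <= hstar.
Hypothesis hL : contraction rho h alpha c0 * L <= 2^-1.
Hypothesis hM : contraction rho h alpha c0 * M <= K / 4.
Hypothesis hpoly : forall u, 0 <= u -> u <= h `^ rho ->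
  `|(taylor b - tube_poly b).[u]| <= K / 4.
Implicit Types (c d : 'I_n.+1 -> R) (psi phi : R -> R).
Notation is_sol := (is_solution sigma rho h alpha H f).
Notation volt := (volterra sigma rho h alpha c0 clipped).

Lemma clipped_lip t y y' : 0 <= t -> t <= h ->
  `|clipped t y - clipped t y'| <= L * `|y - y'|.
Proof.
move=> t0 th; have ths : t <= hstar by exact: le_trans hle.
have cH z : H (t, center t + clip K (z - center t)) by exact: clip_Hset.
rewrite /clipped_field (le_trans (flip (cH y) (cH y')))//.
rewrite ler_wpM2l// opprD addrACA subrr add0r (le_trans (clip_lip K0 _ _))//.
by rewrite opprB addrA subrK.
Qed.

Let forcing_cont := clipped_forcing_continuous hrho K0 h0 hle fcont.

Lemma forcing_clipped_id psi : (forall t, t \in `[0, h] -> H (t, psi t)) ->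
  forall t, 0 <= t -> t <= h ->
  forcing sigma rho h clipped psi t = twist t * f (t, psi t).
Proof.
move=> psiH t t0 th.
have tH : H (t, psi t) by apply: psiH; rewrite in_itv/= t0.
by rewrite /forcing clamp_id// (clipped_id _ t0 tH).
Qed.

Lemma solution_is_volterra c psi : is_sol c psi ->
  {within `[0, h], continuous psi} /\ volt c psi.
Proof.
move=> sol; have [cpsi psiH _ _ _] := sol; split => //.
apply: (solution_volterra hrho h0 halpha alpha_le alpha_gt c0P sol).
  exact: forcing_cont.
by move=> t t0 th; rewrite forcing_clipped_id// ltW.
Qed.

Lemma solution_stable c d e psi phi : is_sol c psi -> is_sol d phi ->
  0 <= e -> (forall k, `|c k - d k| <= e) ->
  forall t, 0 <= t -> t <= h -> `|psi t - phi t| <= 2 * n.+1%:R * e.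
Proof.
move=> /solution_is_volterra[cpsi Vpsi] /solution_is_volterra[cphi Vphi].
exact: (volterra_stable hsigma hrho h0 h1 halpha c00 forcing_cont L0 clipped_lip hL cpsi cphi Vpsi Vphi).
Qed.

(** The distance of psi t to the centre of the tube is at most K / 2 for the
    change of data from b to c, K / 4 for the initial polynomial of b against
    the centre, and K / 4 for the integral. *)
Lemma solution_exists c e : (forall k, `|b k - c k| <= e) -> 0 <= e ->
  n.+1%:R * e <= K / 2 -> exists psi, is_sol c psi.
Proof.
move=> bce e0 eK.
have [psi cpsi V] := volterra_exists hsigma hrho h0 halpha c00 forcing_cont L0 clipped_lip hL c.
have wpsi : {within `[0, h], continuous psi} by exact: continuous_subspaceT.
have psiH t : 0 <= t -> t <= h -> H (t, psi t).
  move=> t0 th; have ths : t <= hstar by exact: le_trans hle.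
  apply/HsetP => //; split => //.
  have cH z : H (t, center t + clip K (z - center t)) by exact: clip_Hset.
  have M0 : 0 <= M.
    by rewrite (le_trans (normr_ge0 _) (fM (cH (psi t)))).
  have u0 := powR_ge0 t rho.
  have uh : t `^ rho <= h `^ rho by rewrite ler_powRl// ltW.
  have u1 : t `^ rho <= 1.
    by have := ler_powRl (ltW hrho) t0 (le_trans th h1); rewrite powR1.
  have b1 : `|(taylor c).[t `^ rho] - (taylor b).[t `^ rho]| <= K / 2.
    by rewrite distrC (le_trans (taylor_dist u0 u1 e0 bce)).
  have b2 := hpoly u0 uh; rewrite hornerD hornerN in b2.
  have b3 : `|(twist t)^-1 * (c0 * rl_integral rho alpha (forcing sigma rho h clipped psi) t)| <= K / 4.
    apply: le_trans hM; apply: (untwist_RLint_le hsigma hrho halpha c00 (forcing_cont wpsi) t0 th M0).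
    move=> s /andP[s0 st]; have sh : s <= h by exact: le_trans (ltW st) th.
    rewrite /forcing clamp_id ?(ltW s0)// normrM (gtr0_norm (twist_gt0 _ _ _)).
    apply: ler_wpM2l; first exact: ltW (twist_gt0 _ _ _).
    by apply: fM; apply: clip_Hset => //; [exact: ltW|exact: le_trans hle].
  rewrite (volterraE V t0 th) /volterra_op /tube_center mulNr expRN -/(twist t).
  rewrite mulrDr addrAC -mulrBr (le_trans (ler_normD _ _))//.
  have := lerD (le_trans (untwist_le rho hsigma _ t0) (le_trans (ler_distD _ _ _) (lerD b1 b2))) b3.
  by move=> bb; apply: (le_trans bb); lra.
exists psi; apply: (volterra_solution hrho h0 halpha alpha_le alpha_gt c0P wpsi psiH (forcing_cont wpsi)).
  move=> t t0 th; rewrite forcing_clipped_id// ?ltW// => s.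
  by rewrite in_itv/= => /andP[s0 sh]; exact: psiH.
exact: V.
Qed.

(** Uniqueness is the stability estimate with equal data. *)
Lemma solution_unique_exists c e : (forall k, `|b k - c k| <= e) -> 0 <= e ->
  n.+1%:R * e <= K / 2 -> solution_defined sigma rho h alpha H f c.
Proof.
move=> bce e0 eK; have [psi sol] := solution_exists bce e0 eK.
exists psi => // phi solphi t; rewrite in_itv/= => /andP[t0 th].
have := solution_stable solphi sol (lexx 0) _ t0 th.
rewrite mulr0 normr_le0 subr_eq0 => E; apply/eqP/E => k.
by rewrite subrr normr0.
Qed.

End InitialValueProblem.

Lemma contraction_cvg0 (R : realType) (rho alpha c0 A : R) : 0 < rho -> 0 < alpha ->
  contraction rho h alpha c0 * A @[h --> 0^'+] --> (0 : R).
Proof.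
move=> hrho halpha.
have -> : (fun h => contraction rho h alpha c0 * A) =
    (fun h => c0 * Beta alpha 1 * A * h `^ (rho * alpha)).
  by apply/funext => h; rewrite /contraction powRrM; ring.
have c : c0 * Beta alpha 1 * A * h `^ (rho * alpha) @[h --> 0^'+] --> c0 * Beta alpha 1 * A * 0.
  by apply: cvgM; [exact: cvg_cst|apply: powR_cvg0; rewrite mulr_gt0].
by rewrite mulr0 in c.
Qed.

Lemma cvg0_near_le (R : realType) (g : R -> R) (e : R) : 0 < e ->
  g h @[h --> 0^'+] --> 0 -> \forall h \near 0^'+, g h <= e.
Proof.
move=> e0 /cvgrPdist_le/(_ e e0); apply: filterS => h.
by rewrite sub0r normrN; apply: le_trans; exact: ler_norm.
Qed.

(** Only the constant terms meet at 0; they agree because 0! = 1 = Gamma 1. *)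
Lemma taylor_tube_poly0 (R : realType) n (b : 'I_n.+1 -> R) :
  (taylor b - tube_poly b).[0] = 0.
Proof.
rewrite hornerD hornerN !horner_coef0 /taylor /tube_poly !coef_sum.
rewrite !big_ord_recl /= !big1 => [|k _|k _]; last 2 first.
- by rewrite coefZ coefXn mulr0.
- by rewrite coefZ coefXn mulr0.
by rewrite !coefZ !coefXn fact0 add0r Gamma1 subrr.
Qed.

Theorem theorem12 (R : realType) (sigma rho alpha K hstar : R) (m : nat)
    (b : 'I_m -> R) (f : R * R -> R) (L : R)
    (hsigma : 0 < sigma) (hrho : 0 < rho) (halpha : 0 < alpha)
    (hm : m%:Z = Num.ceil alpha) (hK : 0 < K) (hhstar : 0 < hstar)
    (fcont : {within Hset sigma rho hstar K b, continuous f})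
    (fbnd : [bounded f p | p in Hset sigma rho hstar K b])
    (hL : 0 < L)
    (flip : forall t y y' : R,
       Hset sigma rho hstar K b (t, y) -> Hset sigma rho hstar K b (t, y') ->
       `|f (t, y) - f (t, y')| <= L * `|y - y'|) :
  exists eps0 h C : R, [/\ 0 < eps0, 0 < h, 0 < C &
    forall c : 'I_m -> R,
      let eps : R := \big[Num.max/0]_(k < m) `|b k - c k| in
      eps <= eps0 ->
      [/\ solution_defined sigma rho h alpha (Hset sigma rho hstar K b) f b,
          solution_defined sigma rho h alpha (Hset sigma rho hstar K b) f c
        & forall psi phi : R -> R,
            is_solution sigma rho h alpha (Hset sigma rho hstar K b) f b psi ->
            is_solution sigma rho h alpha (Hset sigma rho hstar K b) f c phi ->
            (ereal_sup [set (`|psi t - phi t|)%:E | t in `[0%R, h]]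
               <= (C * eps)%:E)%E]].
Proof.
have := ceil_itv alpha; rewrite -hm.
case: m b hm fcont fbnd flip => [|n] b hm fcont fbnd flip /andP[alpha_gt alpha_le].
  by have := lt_le_trans halpha alpha_le; rewrite ltxx.
have {}alpha_gt : n%:R < alpha by move: alpha_gt; rewrite -addn1 PoszD addrK.
have [c0 c00 c0P] := fracint_inverse hrho halpha alpha_le alpha_gt.
have [M M0 fM] : exists2 M : R, 0 < M & forall p, Hset sigma rho hstar K b p -> `|f p| <= M.
  have [A [_ fA]] := fbnd; exists (Num.max 1 (A + 1)); first by rewrite lt_max ltr01.
  by move=> p; apply: fA; rewrite lt_max ltrDl ltr01 orbT.
have K4 : 0 < K / 4 by rewrite divr_gt0.
(* h is such that the integral halves distances, and that the integral and the
   drift of the initial polynomial each use at most a quarter of the tube *)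
have [h [h0 h1 hle] [conL conM hpoly]] : exists2 h, [/\ 0 < h, h <= 1 & h <= hstar] &
    [/\ contraction rho h alpha c0 * L <= 2^-1, contraction rho h alpha c0 * M <= K / 4
    & forall u, 0 <= u -> u <= h `^ rho -> `|(taylor b - tube_poly b).[u]| <= K / 4].
  have half0 : 0 < 2^-1 :> R by rewrite invr_gt0.
  have /cvgrPdist_lt/(_ _ K4)[de /= de0 hde] := @continuous_horner R (taylor b - tube_poly b) 0.
  have de2 : 0 < de / 2 by rewrite divr_gt0.
  near (0 : R)^'+ => h; exists h; split.
  - by near: h; exact: nbhs_right_gt.
  - by near: h; exact: nbhs_right_le.
  - by near: h; exact: nbhs_right_le.
  - by near: h; apply: (cvg0_near_le half0); exact: contraction_cvg0.
  - by near: h; apply: (cvg0_near_le K4); exact: contraction_cvg0.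
  - move=> u u0 uh; have hd : h `^ rho <= de / 2.
      by near: h; apply: (cvg0_near_le de2); exact: powR_cvg0.
    have := hde u; rewrite taylor_tube_poly0 sub0r normrN /= sub0r normrN ger0_norm// => H.
    by apply/ltW/H; move: uh hd de0; lra.
(* the change of the n.+1 data may use the remaining half of the tube *)
pose eps0 : R := K / 2 / n.+1%:R.
exists eps0, h, (2 * n.+1%:R); split => //; first by rewrite !divr_gt0.
move=> c eps epsle.
have bce k : `|b k - c k| <= eps by exact: (le_bigmax 0 (fun k => `|b k - c k|) k).
have eps_nonneg : 0 <= eps by rewrite (le_trans (normr_ge0 _) (bce ord0)).
have epsK : n.+1%:R * eps <= K / 2 by rewrite mulrC -ler_pdivlMr.
split.
- apply: (solution_unique_exists hsigma hrho halpha alpha_le alpha_gt hK fcont fM (ltW hL)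
    flip c00 c0P h0 h1 hle conL conM hpoly _ (lexx 0)).
    by move=> k; rewrite subrr normr0.
  by rewrite mulr0 divr_ge0// ltW.
- exact: (solution_unique_exists hsigma hrho halpha alpha_le alpha_gt hK fcont fM (ltW hL)
    flip c00 c0P h0 h1 hle conL conM hpoly bce eps_nonneg epsK).
- move=> psi phi solpsi solphi; apply: ge_ereal_sup => _ [t /= + <-].
  rewrite in_itv/= => /andP[t0 th]; rewrite lee_fin.
  exact: (solution_stable hsigma hrho halpha alpha_le alpha_gt hK fcont (ltW hL) flip c00 c0P
    h0 h1 hle conL solpsi solphi eps_nonneg bce).
Unshelve. all: end_near. Qed.
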